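(* Let $a>b>c>0$ and let $\mathcal{E}:\ \frac{x^2}{a^2}+\frac{y^2}{b^2}+\frac{z^2}{c^2}=1$. Then: (1) If $a^2<2c^2$, neither sheet of the caustic of $\mathcal{E}$ intersects $\mathcal{E}$. (2) If $b^2<2c^2\le a^2$, exactly one of the two sheets of the caustic intersects $\mathcal{E}$. (3) If $b^2\ge 2c^2$, both sheets of the caustic intersect $\mathcal{E}$. In all cases, for points $A\in\mathcal{E}$: $n(A)=2$ if $A$ lies outside both sheets, $n(A)=4$ if $A$ lies inside exactly one sheet, $n(A)=6$ if $A$ lies inside both sheets, and $n(A)\in\{3,5\}$ if $A$ lies on a sheet, except possibly for some points of $\mathcal{E}$ where the sheets intersect each other or where the sheets meet the coordinate planes.
   Context: For a point $A\in\mathbb{R}^3$, $n(A)$ is the number of points $B\in\mathcal{E}$ such that $A$ lies on the normal line to $\mathcal{E}$ at $B$ (for $A\in\mathcal{E}$, $B=A$ is counted). The caustic of $\mathcal{E}$ has two sheets: for each point $P\in\mathcal{E}$ with outer normal $\mathbf N=(x/a^2,y/b^2,z/c^2)$ and principal curvatures $k_1\le k_2$ (radii $R_i=1/k_i$), the centers of principal curvature are $C_i=P-R_i\mathbf N/|\mathbf N|$; the set of all $C_1$ and the set of all $C_2$ are the two sheets, each a closed surface bounding a region of space (''inside'' the sheet). Equivalently the caustic is the set of $(X,Y,Z)$ for which some $t$ satisfies $\frac{a^2X^2}{(a^2+t)^2}+\frac{b^2Y^2}{(b^2+t)^2}+\frac{c^2Z^2}{(c^2+t)^2}=1$ and $\frac{a^2X^2}{(a^2+t)^3}+\frac{b^2Y^2}{(b^2+t)^3}+\frac{c^2Z^2}{(c^2+t)^3}=0$.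 *)

(* Defs.v *)
From HB Require Import structures.
From mathcomp Require Import all_boot all_order all_algebra.
From mathcomp Require Import all_classical all_reals all_analysis.
Import numFieldTopology.Exports numFieldNormedType.Exports.
Set Implicit Arguments. Unset Strict Implicit. Unset Printing Implicit Defensive.
Import Order.TTheory GRing.Theory Num.Theory.
Local Open Scope classical_set_scope.
Local Open Scope ring_scope.

Section Ellipsoid.
Variable R : realType.
Implicit Types (a b c k : R) (P A B v : R * R * R).

Definition px (p : R * R * R) : R := p.1.1.
Definition py (p : R * R * R) : R := p.1.2.
Definition pz (p : R * R * R) : R := p.2.

Definition onE a b c P : Prop :=
  px P ^+ 2 / a ^+ 2 + py P ^+ 2 / b ^+ 2 + pz P ^+ 2 / c ^+ 2 = 1.

Definition ellipsoid a b c : set (R * R * R) := [set P | onE a b c P].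

Definition Nvec a b c P : R * R * R :=
  (px P / a ^+ 2, py P / b ^+ 2, pz P / c ^+ 2).

Definition dot (u w : R * R * R) : R := px u * px w + py u * py w + pz u * pz w.

Definition normN a b c P : R := Num.sqrt (dot (Nvec a b c P) (Nvec a b c P)).

Definition unit_tangent a b c P v : Prop :=
  dot v (Nvec a b c P) = 0 /\ dot v v = 1.

(* normal curvature of the ellipsoid at P in the unit tangent direction v
   (second fundamental form of the level surface F = 1, F = x^2/a^2+..,
    w.r.t. the inward unit normal): v^T Hess(F) v / |grad F| *)
Definition normal_curv a b c P v : R :=
  (px v ^+ 2 / a ^+ 2 + py v ^+ 2 / b ^+ 2 + pz v ^+ 2 / c ^+ 2) / normN a b c P.

Definition is_k1 a b c P k : Prop :=
  (exists v, unit_tangent a b c P v /\ normal_curv a b c P v = k) /\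
  (forall v, unit_tangent a b c P v -> k <= normal_curv a b c P v).

Definition is_k2 a b c P k : Prop :=
  (exists v, unit_tangent a b c P v /\ normal_curv a b c P v = k) /\
  (forall v, unit_tangent a b c P v -> normal_curv a b c P v <= k).

Definition curv_center a b c P k : R * R * R :=
  (px P - k^-1 * px (Nvec a b c P) / normN a b c P,
   py P - k^-1 * py (Nvec a b c P) / normN a b c P,
   pz P - k^-1 * pz (Nvec a b c P) / normN a b c P).

Definition sheet1 a b c : set (R * R * R) :=
  [set C | exists P k, onE a b c P /\ is_k1 a b c P k /\ C = curv_center a b c P k].
Definition sheet2 a b c : set (R * R * R) :=
  [set C | exists P k, onE a b c P /\ is_k2 a b c P k /\ C = curv_center a b c P k].

Definition bounded3 (X : set (R * R * R)) : Prop :=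
  exists M : R, forall p, X p -> `|px p| <= M /\ `|py p| <= M /\ `|pz p| <= M.

Definition inside (S : set (R * R * R)) A : Prop :=
  ~ S A /\ bounded3 (connected_component (~` S) A).

Definition on_normal a b c B A : Prop :=
  exists s : R, A = (px B + s * px (Nvec a b c B),
                     py B + s * py (Nvec a b c B),
                     pz B + s * pz (Nvec a b c B)).

Definition n_eq a b c A (k : nat) : Prop :=
  exists s : seq (R * R * R), uniq s /\ size s = k /\
    forall B, B \in s <-> (onE a b c B /\ on_normal a b c B A).

Definition meets_E a b c (S : set (R * R * R)) : Prop :=
  exists P, S P /\ onE a b c P.

Definition exceptional a b c A : Prop :=
  (sheet1 a b c A /\ sheet2 a b c A) \/
  ((sheet1 a b c A \/ sheet2 a b c A) /\ (px A = 0 \/ py A = 0 \/ pz A = 0)).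

End Ellipsoid.

(* Main.v *)
Require Import Defs.
From HB Require Import structures.
From mathcomp Require Import all_boot all_order all_algebra.
From mathcomp Require Import all_classical all_reals all_analysis.
From mathcomp Require Import ring lra.
Import numFieldTopology.Exports numFieldNormedType.Exports.
Import Order.TTheory GRing.Theory Num.Theory.
Set Implicit Arguments. Unset Strict Implicit. Unset Printing Implicit Defensive.
Local Open Scope classical_set_scope.
Local Open Scope ring_scope.

(** Write [al, be, ga] for the squares of the semi-axes. A point of the ellipsoid whose
    normal passes through [A = (X, Y, Z)] has coordinates [al X / (al + s)],
    [be Y / (be + s)], [ga Z / (ga + s)] where [s] is a root of
    [F_A(s) = al X^2 / (al + s)^2 + be Y^2 / (be + s)^2 + ga Z^2 / (ga + s)^2 = 1].
    On either side of the poles [F_A] is monotone and gives one root ([s = 0] is one of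
    them when [A] is on the ellipsoid); between two consecutive poles [F_A] is strictly
    convex and gives 2, 1 or 0 roots according to the position of its minimum with
    respect to 1. By Lagrange multipliers the minimum over [[-al, -be]] (resp.
    [[-be, -ga]]) is 1 exactly when [A] is a center of curvature for the smaller (resp.
    larger) principal curvature, so the locus "minimum = 1" is a sheet of the caustic.
    The loci "minimum < 1" and "minimum > 1" are open, the first one is bounded and the
    second one is stable under dilations, hence the first one is the inside of the sheet.

    If [A] lies in a coordinate plane, one pole of [F_A] disappears; the roots that have
    moved through that pole are replaced by two feet with the value of [s] at the pole
    and opposite coordinates. Attaching each of these feet to one side of the pole keeps
    the above count valid.

    Since [F_A(0) = 1] on the ellipsoid, comparing [|al_i + s|] with [al_i] shows when a
    sheet misses it; otherwise an arc from [(0, 0, c)] to [(a, 0, 0)] meets the sheet. *)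

(** * Sums of three inverse squares *)

Section InverseSquares.
Variable R : realType.
Implicit Types (p q r x y z e s t u m k : R).

Definition invsq p q r x y z s :=
  x / (p + s) ^+ 2 + y / (q + s) ^+ 2 + z / (r + s) ^+ 2.

Definition invcube p q r x y z s :=
  x / (p + s) ^+ 3 + y / (q + s) ^+ 3 + z / (r + s) ^+ 3.

(* Since [0 / 0 = 0], [invsq] drops the terms with a zero numerator; [s] is admissible
   when no other denominator vanishes. *)
Definition admissible p q r x y z s :=
  [/\ x != 0 -> p + s != 0, y != 0 -> q + s != 0 & z != 0 -> r + s != 0].

(** The reflection [s -> - s], with poles and numerators listed backwards, exchanges the two
    intervals between consecutive poles; results on [[-p, -q]] thus transfer to [[-q, -r]]. *)
Lemma invsq_opp p q r x y z s :
  invsq (- r) (- q) (- p) z y x (- s) = invsq p q r x y z s.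
Proof. by rewrite /invsq -!opprD !sqrrN addrC (addrC (z / _)) addrA. Qed.

Lemma invcube_opp p q r x y z s :
  invcube (- r) (- q) (- p) z y x (- s) = - invcube p q r x y z s.
Proof.
have cubeN (v : R) : (- v) ^+ 3 = - v ^+ 3 by ring.
by rewrite /invcube -!opprD !cubeN !invrN; ring.
Qed.

Lemma admissible_opp p q r x y z s :
  admissible (- r) (- q) (- p) z y x (- s) <-> admissible p q r x y z s.
Proof. by rewrite /admissible -!opprD !oppr_eq0; split=> -[]. Qed.

(** Convexity of [k |-> e / k ^+ 2] on each side of 0: the graph lies above its tangent at [m], the
    difference having the factor [(m - k) ^+ 2]. The sign condition bears on nonzero [e] only, so
    that removable poles are covered. *)
Lemma tangent_le e m k : 0 <= e -> (e != 0 -> 0 < m * k) ->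
  e / m ^+ 2 - 2 * (e / m ^+ 3) * (k - m) <= e / k ^+ 2.
Proof.
rewrite le_eqVlt => /predU1P[<- _|e0]; first by rewrite !mul0r mulr0 mul0r subr0.
rewrite gt_eqF// => /(_ isT) mk.
have m0 : m != 0 by apply: contraTneq mk => ->; rewrite mul0r ltxx.
have k0 : k != 0 by apply: contraTneq mk => ->; rewrite mulr0 ltxx.
rewrite -subr_ge0.
have -> : e / k ^+ 2 - (e / m ^+ 2 - 2 * (e / m ^+ 3) * (k - m)) =
  e * (m - k) ^+ 2 * (m ^+ 2 + 2 * (m * k)) / (m ^+ 2 * k) ^+ 2.
  by field; rewrite m0 k0.
rewrite divr_ge0 ?sqr_ge0// mulr_ge0//; first by rewrite mulr_ge0 ?sqr_ge0 ?ltW.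
by rewrite addr_ge0 ?sqr_ge0// mulr_ge0// ltW.
Qed.

Lemma tangent_lt e m k : 0 < e -> 0 < m * k -> m != k ->
  e / m ^+ 2 - 2 * (e / m ^+ 3) * (k - m) < e / k ^+ 2.
Proof.
move=> e0 mk mNk.
have m0 : m != 0 by apply: contraTneq mk => ->; rewrite mul0r ltxx.
have k0 : k != 0 by apply: contraTneq mk => ->; rewrite mulr0 ltxx.
rewrite -subr_gt0.
have -> : e / k ^+ 2 - (e / m ^+ 2 - 2 * (e / m ^+ 3) * (k - m)) =
  e * (m - k) ^+ 2 * (m ^+ 2 + 2 * (m * k)) / (m ^+ 2 * k) ^+ 2.
  by field; rewrite m0 k0.
rewrite divr_gt0// ?exprn_even_gt0//= ?mulf_neq0 ?expf_neq0//.
rewrite mulr_gt0//; first by rewrite mulr_gt0// exprn_even_gt0//= subr_eq0.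
by rewrite ltr_wpDl ?sqr_ge0// mulr_gt0.
Qed.

(** * Strict convexity and the minimum between two consecutive poles *)

Section Interval.
Variables p q r x y z : R.
Hypotheses (qp : q < p) (rq : r < q).
Hypotheses (x0 : 0 <= x) (y0 : 0 <= y) (z0 : 0 <= z).
Local Notation H := (invsq p q r x y z).
Local Notation dH := (invcube p q r x y z).
Local Notation ad := (admissible p q r x y z).

Lemma admissible_inside s : - p < s -> s < - q -> ad s.
Proof.
have ? := qp; have ? := rq; move=> ps sq.
by split=> _; [apply: lt0r_neq0|apply: ltr0_neq0..]; lra.
Qed.

Lemma invsq_ge0 s : 0 <= H s.
Proof. by rewrite /invsq !addr_ge0// divr_ge0// sqr_ge0. Qed.

Hypothesis nz : 0 < x + y + z.

Local Ltac import_hyps :=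
  have ? := qp; have ? := rq; have ? := x0; have ? := y0; have ? := z0;
  have ? := nz.

(** Strict convexity, end points with a removable pole included: the three tangent inequalities add
    up, and any nonzero numerator makes its own strict. *)
Lemma invsq_tangent s t : - p <= s -> s <= - q -> - p <= t -> t <= - q ->
  ad s -> ad t -> s != t -> H s - 2 * dH s * (t - s) < H t.
Proof.
import_hyps.
move=> ps sq pt tq [xs ys zs] [xt yt zt] st.
have xT : x != 0 -> 0 < (p + s) * (p + t).
  move=> xn; rewrite mulr_gt0// lt_neqAle eq_sym ?xs ?xt//=; lra.
have yT : y != 0 -> 0 < (q + s) * (q + t).
  move=> yn; rewrite nmulr_rgt0// lt_neqAle ?ys ?yt//=; lra.
have zT : z != 0 -> 0 < (r + s) * (r + t).
  by move=> zn; rewrite nmulr_rgt0; lra.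
rewrite /invsq /invcube.
have Tx := tangent_le x0 xT; have Ty := tangent_le y0 yT.
have Tz := tangent_le z0 zT.
have dE v : v + t - (v + s) = t - s by ring.
have [xp|xp] := ltrP 0 x.
  have := @tangent_lt x (p + s) (p + t) xp (xT (lt0r_neq0 xp)).
  by rewrite (inj_eq (addrI _)) => /(_ st); rewrite !dE in Ty Tz *; lra.
have [yp|yp] := ltrP 0 y.
  have := @tangent_lt y (q + s) (q + t) yp (yT (lt0r_neq0 yp)).
  by rewrite (inj_eq (addrI _)) => /(_ st); rewrite !dE in Tx Tz *; lra.
have zp : 0 < z by lra.
have := @tangent_lt z (r + s) (r + t) zp (zT (lt0r_neq0 zp)).
by rewrite (inj_eq (addrI _)) => /(_ st); rewrite !dE in Tx Ty *; lra.
Qed.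

(* First-order conditions for a minimum on [[-p, -q]]: the derivative of [invsq] is
   [-2 invcube]. *)
Definition stationary s0 := [/\ - p <= s0, s0 <= - q, ad s0,
  s0 < - q -> dH s0 <= 0 & - p < s0 -> 0 <= dH s0].

Lemma stationary_left : x = 0 -> stationary (- p).
Proof.
import_hyps.
move=> xE; split; rewrite ?ltxx//; first lra.
  by split=> [|_|_]; rewrite ?xE ?eqxx// lt_eqF//; lra.
move=> _; rewrite /invcube xE mul0r add0r; rewrite -[leRHS]addr0 lerD//.
  by rewrite mulr_ge0_le0// invr_le0 exprn_odd_le0//; lra.
by rewrite mulr_ge0_le0// invr_le0 exprn_odd_le0//; lra.
Qed.

Lemma stationary_right : y = 0 -> 0 <= dH (- q) -> stationary (- q).
Proof.
import_hyps.
move=> yE d0; split; rewrite ?ltxx//; first lra.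
by split=> [_||_]; rewrite ?yE ?eqxx//; lra.
Qed.

(** If [x = 0] the left end is a minimum; if [y = 0] and [invcube] is nonnegative at [-q], the right
    end is one; otherwise [invcube] vanishes inside, by the intermediate value theorem for
    polynomials after clearing denominators. *)
Lemma stationary_exists : exists s0, stationary s0.
Proof.
import_hyps.
have [xp|xn] := ltrP 0 x; last first.
  have xE : x = 0 by lra.
  by exists (- p); exact: stationary_left.
pose cub (v : R) : {poly R} := ('X + v%:P) ^+ 3.
have [yp|yn] := ltrP 0 y.
  (* Minus the numerator of [invcube]. At each end only the term of the vanishing pole survives,
     which gives the signs [P.[- p] <= 0 <= P.[- q]]. *)
  pose P := - (x%:P * cub q * cub r + y%:P * cub p * cub r + z%:P * cub p * cub q).
  have PE s : P.[s] = - (x * (q + s) ^+ 3 * (r + s) ^+ 3 +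
      y * (p + s) ^+ 3 * (r + s) ^+ 3 + z * (p + s) ^+ 3 * (q + s) ^+ 3).
    by rewrite /P /cub !hornerE !(addrC s).
  have [||s0] := @poly_ivt R P (- p) (- q); first lra.
    have cp v : v <= p -> (v - p) ^+ 3 <= 0 by move=> ?; rewrite exprn_odd_le0//; lra.
    rewrite !PE !subrr !expr0n /= !(mulr0, mul0r) !addr0 add0r oppr_le0 oppr_ge0.
    apply/andP; split.
      by rewrite -mulrA mulr_ge0// mulr_le0// cp//; lra.
    rewrite mulr_ge0_le0// ?mulr_ge0 ?exprn_ge0 ?exprn_odd_le0//; lra.
  move=> /andP[ps sq] /rootP; rewrite PE => sr.
  have sNp : - p != s0.
    apply/eqP => sp; move: sr; rewrite -sp subrr expr0n /= !(mulr0, mul0r) !addr0.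
    by move/eqP; apply/negP; rewrite oppr_eq0 !mulf_neq0 ?expf_neq0//; lra.
  have sNq : s0 != - q.
    apply/eqP => sp; move: sr; rewrite sp subrr expr0n /= !(mulr0, mul0r) addr0 add0r.
    by move/eqP; apply/negP; rewrite oppr_eq0 !mulf_neq0 ?expf_neq0//; lra.
  have {}ps : - p < s0 by rewrite lt_neqAle sNp.
  have {}sq : s0 < - q by rewrite lt_neqAle sNq.
  have d0 : dH s0 = 0.
    rewrite /invcube.
    have n1 : p + s0 != 0 by lra.
    have n2 : q + s0 != 0 by lra.
    have n3 : r + s0 != 0 by lra.
    apply/eqP; rewrite -(mulIr_eq0 _ (mulIf (expf_neq0 3 (mulf_neq0 (mulf_neq0 n1 n2) n3)))).
    apply/eqP; rewrite -[RHS]oppr0 -sr; field.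
    by rewrite n1 n2 n3.
  by exists s0; split; [exact: ltW|exact: ltW|exact: admissible_inside|rewrite d0..].
have yE : y = 0 by lra.
have [d0|d0] := lerP 0 (dH (- q)).
  by exists (- q); exact: stationary_right.
(* Here [y = 0] and [dH (- q) < 0]; the cleared denominator is negative at [-q], so [P] is positive
   there, while [P.[- p]] has the sign of [r - p]. *)
pose P := x%:P * cub r + z%:P * cub p.
have PE s : P.[s] = x * (r + s) ^+ 3 + z * (p + s) ^+ 3.
  by rewrite /P /cub !hornerE !(addrC s).
have P2 s : - p < s -> s <= - q -> P.[s] = dH s * ((p + s) ^+ 3 * (r + s) ^+ 3).
  move=> ps sq; rewrite PE /invcube yE mul0r addr0.
  by field; apply/andP; split; lra.
have [||s0] := @poly_ivt R P (- p) (- q); first lra.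
  rewrite (P2 (- q)) ?PE; try lra.
  rewrite subrr expr0n /= mulr0 addr0 mulr_ge0_le0//=; last first.
    by rewrite exprn_odd_le0//; lra.
  rewrite mulr_le0//; first lra.
  by rewrite mulr_ge0_le0// ?exprn_ge0 ?exprn_odd_le0//; lra.
move=> /andP[ps sq] /rootP => sr.
have {}ps : - p < s0.
  rewrite lt_neqAle ps andbT; apply/eqP => sp; move: sr; rewrite PE -sp subrr expr0n /=.
  by rewrite mulr0 addr0 => /eqP; apply/negP; rewrite mulf_neq0 ?expf_neq0//; lra.
have dd : dH s0 = 0.
  move: sr; rewrite P2// => /eqP; rewrite mulf_eq0 => /orP[/eqP//|].
  by move=> h; exfalso; move: h; apply/negP; rewrite mulf_neq0 ?expf_neq0//; lra.
have {}sq : s0 < - q.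
  by rewrite lt_neqAle sq andbT; apply/eqP => sp; move: d0; rewrite -sp dd ltxx.
by exists s0; split; [exact: ltW|exact: ltW|exact: admissible_inside|rewrite dd..].
Qed.

(** For [s0 < s], the tangent at [s0] gives [H s0 < H s]; the tangent at [s], evaluated at [s0],
    then forces [dH s < 0], and evaluated at [t] it gives [H s < H t]. *)
Lemma stationary_incr s0 : stationary s0 ->
  forall s t, s0 <= s -> s < t -> t <= - q -> ad s -> ad t -> H s < H t.
Proof.
import_hyps.
move=> [ps0 s0q ad0 dr dl] s t; rewrite le_eqVlt => /predU1P[<-|s0s] st tq ads adt.
  have := @invsq_tangent s0 t ps0 s0q; rewrite lt_eqF//.
  have := dr ltac:(lra) => d0 /(_ _ tq ad0 adt isT); move/(_ ltac:(lra)).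
  by have : 0 <= (- dH s0) * (t - s0) by [rewrite mulr_ge0//; lra]; lra.
have T1 : H s0 < H s.
  have := @invsq_tangent s0 s ps0 s0q; rewrite lt_eqF//.
  have := dr ltac:(lra) => d0 /(_ ltac:(lra) ltac:(lra) ad0 ads isT).
  by have : 0 <= (- dH s0) * (s - s0) by [rewrite mulr_ge0//; lra]; lra.
have T2 := @invsq_tangent s s0 ltac:(lra) ltac:(lra) ltac:(lra) ltac:(lra) ads ad0.
have {}T2 := T2 ltac:(by rewrite gt_eqF).
have dn : dH s < 0.
  rewrite ltNge; apply/negP => dp.
  by have : 0 <= dH s * (s - s0) by [rewrite mulr_ge0//; lra]; lra.
have := @invsq_tangent s t ltac:(lra) ltac:(lra) ltac:(lra) ltac:(lra) ads adt.
rewrite lt_eqF// => /(_ isT).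
by have : 0 <= (- dH s) * (t - s) by [rewrite mulr_ge0//; lra]; lra.
Qed.

Lemma stationary_decr s0 : stationary s0 ->
  forall s t, - p <= s -> s < t -> t <= s0 -> ad s -> ad t -> H t < H s.
Proof.
import_hyps.
move=> [ps0 s0q ad0 dr dl] s t ps st; rewrite le_eqVlt => /predU1P[tE|ts0] ads adt.
  rewrite tE in st *.
  have := @invsq_tangent s0 s ps0 s0q ltac:(lra) ltac:(lra) ad0 ads.
  rewrite gt_eqF//.
  have := dl ltac:(lra) => d0 /(_ isT).
  by have : 0 <= (dH s0) * (s0 - s) by [rewrite mulr_ge0//; lra]; lra.
have T1 : H s0 < H t.
  have := @invsq_tangent s0 t ps0 s0q ltac:(lra) ltac:(lra) ad0 adt.
  rewrite gt_eqF//.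
  have := dl ltac:(lra) => d0 /(_ isT).
  by have : 0 <= (dH s0) * (s0 - t) by [rewrite mulr_ge0//; lra]; lra.
have T2 := @invsq_tangent t s0 ltac:(lra) ltac:(lra) ltac:(lra) ltac:(lra) adt ad0.
have {}T2 := T2 ltac:(by rewrite lt_eqF).
have dn : 0 < dH t.
  rewrite ltNge; apply/negP => dp.
  by have : 0 <= (- dH t) * (s0 - t) by [rewrite mulr_ge0//; lra]; lra.
have := @invsq_tangent t s ltac:(lra) ltac:(lra) ltac:(lra) ltac:(lra) adt ads.
rewrite gt_eqF// => /(_ isT).
by have : 0 <= (dH t) * (t - s) by [rewrite mulr_ge0//; lra]; lra.
Qed.

Lemma stationary_min s0 : stationary s0 ->
  forall s, - p <= s -> s <= - q -> ad s -> H s0 <= H s.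
Proof.
import_hyps.
move=> st s ps sq ads; have [ps0 s0q ad0 _ _] := st.
have [ss0|ss0|->//] := ltgtP s s0.
  exact/ltW/(stationary_decr st).
exact/ltW/(stationary_incr st).
Qed.

(** The tangent at a critical point is horizontal, so strict convexity would put [H s0] above [H s]
    if the points differed. *)
Lemma stationary_uniq s0 s : stationary s0 -> - p < s -> s < - q ->
  dH s = 0 -> s = s0.
Proof.
import_hyps.
move=> st ps sq d0; have [ps0 s0q ad0 _ _] := st.
have ads := admissible_inside ps sq.
apply/eqP; apply: contraT => ne.
have := @invsq_tangent s s0 (ltW ps) (ltW sq) ps0 s0q ads ad0 ne.
have := stationary_min st (ltW ps) (ltW sq) ads; rewrite d0; lra.
Qed.

End Interval.
End InverseSquares.

(** * Counting the solutions of [invsq = 1] *)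

Section Counting.
Variable T : eqType.
Implicit Types P Q : T -> Prop.

(** Same shape as [n_eq], so that counting solutions of an equation amounts to counting feet of
    normals. *)
Definition has_card P (n : nat) :=
  exists s : seq T, uniq s /\ size s = n /\ forall x, x \in s <-> P x.

Lemma has_card_ext P Q n : (forall x, P x <-> Q x) -> has_card P n -> has_card Q n.
Proof.
by move=> PQ [s [us [ss sP]]]; exists s; do 2!split=> //; move=> x; rewrite sP.
Qed.

Lemma has_card0 P : (forall x, ~ P x) -> has_card P 0.
Proof. by move=> nP; exists [::]; do 2!split=> //; move=> x; split=> // /nP. Qed.

Lemma has_card1 P x0 : (forall x, P x <-> x = x0) -> has_card P 1.
Proof.
move=> P1; exists [:: x0]; do 2!split=> //; move=> x.
by rewrite inE P1; split=> [/eqP|->].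
Qed.

Lemma has_cardU P Q m n : has_card P m -> has_card Q n ->
  (forall x, P x -> Q x -> False) -> has_card (fun x => P x \/ Q x) (m + n).
Proof.
move=> [s [us [ss sP]]] [t [ut [st tQ]]] PQ; exists (s ++ t); split; last first.
  rewrite size_cat ss st; split=> // x; rewrite mem_cat; split.
    by case/orP => [/sP|/tQ]; [left|right].
  by case=> [/sP ->|/tQ ->]; rewrite ?orbT.
rewrite cat_uniq us ut andbT; apply/hasPn => x /tQ Qx.
by apply/negP => /sP Px; exact: PQ Px Qx.
Qed.
End Counting.

Lemma has_card_image (T U : eqType) (f : T -> U) (P : T -> Prop) (Q : U -> Prop) n :
  (forall x y, P x -> P y -> f x = f y -> x = y) ->
  (forall y, Q y <-> exists2 x, P x & y = f x) ->
  has_card P n -> has_card Q n.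
Proof.
move=> f_inj QP [s [us [ss sP]]]; exists (map f s); rewrite size_map map_inj_in_uniq.
  do 2!split=> //; move=> y; rewrite QP; split.
    by case/mapP => x /sP Px ->; exists x.
  by case=> x /sP xs ->; rewrite map_f.
by move=> x y /sP Px /sP Py; exact: f_inj.
Qed.

(** * A monotone branch ending at a pole *)

Section Branch.
Variable R : realType.
Implicit Types (f : R -> R) (s t p e : R).

Lemma invsq_term_continuous e p s : (e != 0 -> p + s != 0) ->
  {for s, continuous (fun u => e / (p + u) ^+ 2)}.
Proof.
have [->|e0 /(_ isT) ps] := eqVneq e 0.
  move=> _; rewrite (_ : (fun _ => _) = cst 0); first exact: cst_continuous.
  by apply/funext => u; rewrite mul0r.
apply: cvgM; first exact: cvg_cst.
apply: cvgV; first by rewrite expf_neq0.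
rewrite expr2; apply: cvgM; apply: cvgD; by [exact: cvg_cst|exact: cvg_id].
Qed.

Lemma invsq_continuous p q r x y z s : admissible p q r x y z s ->
  {for s, continuous (invsq p q r x y z : R -> R)}.
Proof.
case=> xs ys zs; apply: cvgD; last exact: invsq_term_continuous.
by apply: cvgD; exact: invsq_term_continuous.
Qed.

Lemma large_near_pole e d : 0 < e -> 0 < d ->
  exists2 k, 0 < k < d & 1 < e / k ^+ 2.
Proof.
(* The second bound gives [k ^+ 2 < e], because [e < (e + 1) ^+ 2]. *)
move=> e0 d0; exists (Num.min (d / 2) (e / (e + 1))).
  by rewrite lt_min gt_min; apply/andP; split; [apply/andP; split|apply/orP; left];
    rewrite ?divr_gt0//; lra.
set k := Num.min _ _.
have k0 : 0 < k by rewrite lt_min !divr_gt0//; lra.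
have ke : k <= e / (e + 1) by rewrite ge_min lexx orbT.
rewrite ltr_pdivlMr ?exprn_gt0// mul1r.
apply: (@le_lt_trans _ _ ((e / (e + 1)) ^+ 2)).
  by rewrite ler_pXn2r// nnegrE ltW// divr_gt0//; lra.
rewrite expr_div_n ltr_pdivrMr; last by rewrite exprn_gt0//; lra.
by rewrite (expr2 e) ltr_pM2l//; nra.
Qed.

(* A solution of [f = 1] is a pair [(s, 0)] with [f s = 1] or, when the pole [p] is
   removable (hypothesis [ad]), a pair [(p, w)] where [w] makes up for the lack
   [1 - f p] and has the sign of [sg]. *)
Definition branch f (ad : Prop) t0 p sg (c : R * R) :=
  [/\ t0 < c.1, c.1 < p, c.2 = 0 & f c.1 = 1] \/
  [/\ c.1 = p, ad, 0 < sg * c.2 & f p + c.2 ^+ 2 = 1].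

(** If the pole is genuine, or removable with [f p > 1], the intermediate value theorem and
    monotonicity give one root before [p]. If it is removable with [f p < 1], no root lies before
    [p], and [sg] selects one of the two opposite values of [w]. *)
Lemma branch_unique f (ad : Prop) t0 p sg :
  sg ^+ 2 = 1 -> t0 <= p -> f t0 < 1 ->
  (forall s t, t0 <= s -> s < t -> t < p -> f s < f t) ->
  (forall s, t0 <= s -> s < p -> {for s, continuous f}) ->
  (ad -> [/\ f p != 1, {for p, continuous f} &
             forall s, t0 <= s -> s < p -> f s < f p]) ->
  (~ ad -> exists p', [/\ t0 < p', p' < p & 1 < f p']) ->
  exists c0, forall c, branch f ad t0 p sg c <-> c = c0.
Proof.
move=> sg2 t0p f0 incr cont adP nadP.
have uniqf s t : t0 <= s -> s < p -> t0 <= t -> t < p -> f s = 1 -> f t = 1 -> s = t.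
  move=> t0s sp t0t tp fs ft; have [st|st|//] := ltgtP s t.
    by have := incr _ _ t0s st tp; rewrite fs ft ltxx.
  by have := incr _ _ t0t st sp; rewrite fs ft ltxx.
have ivt b : t0 < b -> (forall s, t0 <= s -> s <= b -> {for s, continuous f}) ->
    1 < f b -> exists2 s, t0 < s < b & f s = 1.
  move=> t0b contb fb; have [||s] := @IVT R f t0 b 1 (ltW t0b).
  - apply: continuous_in_subspaceT => s /set_mem /=; rewrite in_itv /= => /andP[? ?].
    exact: contb.
  - by rewrite ge_min le_max (ltW f0) (ltW fb) orbT.
  rewrite in_itv /= => /andP[t0s sb] fs; exists s => //.
  rewrite !lt_neqAle t0s sb !andbT; apply/andP; split.
    by apply: contraTneq f0 => ->; rewrite fs ltxx.
  by apply: contraTneq fb => <-; rewrite fs ltxx.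
have [adp|nad] := pselect ad; last first.
  have [p' [tp' p'p fp']] := nadP nad.
  have [|//|s /andP[t0s sp] fs] := ivt _ tp'.
    by move=> s t0s sp'; apply: cont => //; exact: le_lt_trans p'p.
  exists (s, 0) => -[u w] /=; split; last first.
    by case=> -> ->; left; split=> //=; exact: lt_trans p'p.
  case=> /= [[t0u up -> fu]|[_ /nad//]]; congr (_, _).
  by apply: uniqf => //; rewrite ?(ltW t0u) ?(ltW t0s)//; exact: lt_trans p'p.
have [fp1 contp incrp] := adP adp.
have [fp|fp|fpE] := ltgtP (f p) 1; last by rewrite fpE eqxx in fp1.
  exists (p, sg * Num.sqrt (1 - f p)) => -[u w] /=.
  have sqE : Num.sqrt (1 - f p) ^+ 2 = 1 - f p by rewrite sqr_sqrtr// subr_ge0 ltW.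
  split; last first.
    case=> -> ->; right; split=> //=.
      by rewrite mulrA -expr2 sg2 mul1r sqrtr_gt0 subr_gt0.
    by rewrite exprMn sg2 mul1r sqE; ring.
  case=> /= [[t0u up _ fu]|[-> _ w0 fw]].
    by have := incrp u (ltW t0u) up; rewrite fu => /(lt_trans fp); rewrite ltxx.
  congr (_, _).
  have -> : 1 - f p = (sg * w) ^+ 2 by rewrite exprMn sg2 mul1r -fw; ring.
  by rewrite sqrtr_sqr gtr0_norm// mulrA -expr2 sg2 mul1r.
have t0p' : t0 < p.
  by rewrite lt_neqAle t0p andbT; apply: contraTneq f0 => ->; rewrite -leNgt ltW.
have [|//|s /andP[t0s sp] fs] := ivt _ t0p'.
  by move=> s t0s; rewrite le_eqVlt => /predU1P[->//|sp]; exact: cont.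
exists (s, 0) => -[u w] /=; split; last by case=> -> ->; left.
case=> /= [[t0u up -> fu]|[_ _ _ fw]].
  by congr (_, _); apply: uniqf => //; exact: ltW.
by exfalso; have := sqr_ge0 w; lra.
Qed.

End Branch.

(** * Solutions attached to an interval between two poles *)

Section MiddleGroup.
Variable R : realType.
Variables p q r x y z : R.
Hypotheses (qp : q < p) (rq : r < q).
Hypotheses (x0 : 0 <= x) (y0 : 0 <= y) (z0 : 0 <= z) (nz : 0 < x + y + z).
Local Notation H := (invsq p q r x y z).
Local Notation ad := (admissible p q r x y z).

Local Ltac import_hyps :=
  have ? := qp; have ? := rq; have ? := x0; have ? := y0; have ? := z0;
  have ? := nz.

(** Of the two opposite feet above a removable end pole, [sgp] and [sgq] select the one attributed
    to this interval. *)
Definition middle_group sgp sgq (c : R * R) :=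
  [\/ [/\ - p < c.1, c.1 < - q, c.2 = 0 & H c.1 = 1],
      [/\ c.1 = - p, ad (- p), 0 < sgp * c.2 & H (- p) + c.2 ^+ 2 = 1] |
      [/\ c.1 = - q, ad (- q), 0 < sgq * c.2 & H (- q) + c.2 ^+ 2 = 1]].

Variables (sgp sgq s0 : R).
Hypotheses (sgp2 : sgp ^+ 2 = 1) (sgq2 : sgq ^+ 2 = 1).
Hypothesis st : stationary p q r x y z s0.

Lemma middle_group_gt1 : 1 < H s0 -> has_card (middle_group sgp sgq) 0.
Proof.
move=> H1; apply: has_card0 => -[s w] /=.
have H2 := stationary_min qp rq x0 y0 z0 nz st.
have gt1 v : - p <= v -> v <= - q -> ad v -> H v + w ^+ 2 <> 1.
  move=> pv vq adv; apply/eqP; rewrite gt_eqF//.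
  by rewrite (lt_le_trans H1)// (le_trans (H2 _ pv vq adv))// lerDl sqr_ge0.
have pq : - p <= - q by rewrite lerN2 ltW.
case=> /= -[]; last 2 first.
- by move=> _ adp _; exact: gt1.
- by move=> _ adq _; exact: gt1.
move=> ps sq w0 Hs; apply: (gt1 s); rewrite ?ltW//.
  exact: admissible_inside.
by rewrite Hs w0 expr0n addr0.
Qed.

(** Both end poles are genuine, so only interior roots remain, and strict monotonicity on either
    side of [s0] leaves [s0] alone. *)
Lemma middle_group_eq1 : x != 0 -> y != 0 -> H s0 = 1 ->
  has_card (middle_group sgp sgq) 1.
Proof.
import_hyps; move=> xn yn H1; have [ps0 s0q ad0 _ _] := st.
have incr := stationary_incr qp rq x0 y0 z0 nz st.
have decr := stationary_decr qp rq x0 y0 z0 nz st.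
have nadp : ~ ad (- p) by case=> /(_ xn); rewrite subrr eqxx.
have nadq : ~ ad (- q) by case=> _ /(_ yn); rewrite subrr eqxx.
apply: (@has_card1 _ _ (s0, 0)) => -[s w] /=; split; last first.
  case=> -> ->; apply: Or31; split=> //=; rewrite lt_neqAle ?ps0 ?s0q andbT.
    by apply/eqP => sE; apply: nadp; rewrite sE.
  by apply/eqP => sE; apply: nadq; rewrite -sE.
case=> /= -[//].
move=> ps sq -> Hs; congr (_, _).
have ads := admissible_inside x y z qp rq ps sq.
have [ss0|ss0|//] := ltgtP s s0.
  by have := decr _ _ (ltW ps) ss0 (lexx _) ads ad0; lra.
by have := incr _ _ (lexx _) ss0 (ltW sq) ad0 ads; lra.
Qed.

(** The minimum splits the interval into two monotone branches, each carrying one solution by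
    [branch_unique]; the decreasing one becomes increasing under [s -> - s]. *)
Lemma middle_group_lt1 : (ad (- p) -> H (- p) != 1) -> (ad (- q) -> H (- q) != 1) ->
  H s0 < 1 -> has_card (middle_group sgp sgq) 2.
Proof.
import_hyps; move=> adp1 adq1 H1; have [ps0 s0q ad0 _ _] := st.
have incr := stationary_incr qp rq x0 y0 z0 nz st.
have decr := stationary_decr qp rq x0 y0 z0 nz st.
have adr s : s0 <= s -> s < - q -> ad s.
  rewrite le_eqVlt => /predU1P[<-//|s0s] sq.
  by apply: admissible_inside => //; exact: le_lt_trans s0s.
have adl s : - p < s -> s <= s0 -> ad s.
  move=> ps; rewrite le_eqVlt => /predU1P[->//|ss0].
  by apply: admissible_inside => //; exact: lt_le_trans s0q.
have right : exists c0, forall c, branch H (ad (- q)) s0 (- q) sgq c <-> c = c0.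
  apply: branch_unique => //.
  - move=> s t s0s s_t tq; apply: incr => //; [exact: ltW|exact: adr (lt_trans s_t tq)|].
    by apply: adr => //; exact: le_trans (ltW s_t).
  - by move=> s s0s sq; apply: invsq_continuous; exact: adr.
  - move=> adq; split; [exact: adq1|exact: invsq_continuous|].
    by move=> s s0s sq; apply: incr => //; exact: adr.
  - move=> nadq.
    have yn : y != 0.
      apply: contra_notN nadq => /eqP yE.
      by split=> [_||_]; rewrite ?yE ?eqxx//; lra.
    have s0q' : s0 < - q.
      by rewrite lt_neqAle s0q andbT; apply: contra_not_neq nadq => <-.
    have yp : 0 < y by rewrite lt_neqAle eq_sym yn.
    have d0 : 0 < - q - s0 by rewrite subr_gt0.
    have [k /andP[k0 kd] k1] := large_near_pole yp d0.
    exists (- q - k); split; [lra|lra|].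
    apply: (lt_le_trans k1); rewrite /invsq (_ : q + (- q - k) = - k); last by ring.
    by rewrite sqrrN addrAC lerDr addr_ge0// divr_ge0// sqr_ge0.
pose f := invsq (- r) (- q) (- p) z y x.
have fE u : f u = H (- u) by rewrite -[u in LHS]opprK /f invsq_opp.
have left_ : exists c0, forall c, branch f (ad (- p)) (- s0) p sgp c <-> c = c0.
  apply: branch_unique => //.
  - lra.
  - by rewrite fE opprK.
  - move=> s t s0s s_t tp; rewrite !fE; apply: decr; rewrite ?ltrN2//; [lra|lra|apply: adl; lra..].
  - move=> s s0s sp; apply: invsq_continuous.
    by rewrite -[s]opprK admissible_opp; apply: adl; lra.
  - move=> adp; rewrite fE; split; [exact: adp1| |].
      by apply: invsq_continuous; rewrite -[p in X in admissible _ _ _ _ _ _ X]opprK admissible_opp.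
    by move=> s s0s sp; rewrite fE; apply: decr => //; [lra|lra|apply: adl; lra].
  - move=> nadp.
    have xn : x != 0.
      apply: contra_notN nadp => /eqP xE.
      by split=> [|_|_]; rewrite ?xE ?eqxx//; lra.
    have ps0' : - p < s0.
      by rewrite lt_neqAle ps0 andbT; apply: contra_not_neq nadp => ->.
    have xp : 0 < x by rewrite lt_neqAle eq_sym xn.
    have d0 : 0 < p + s0 by lra.
    have [k /andP[k0 kd] k1] := large_near_pole xp d0.
    exists (p - k); split; [lra|lra|].
    apply: (lt_le_trans k1); rewrite fE /invsq (_ : p - (p - k) = k); last by ring.
    by rewrite -addrA lerDl addr_ge0// divr_ge0// sqr_ge0.
have {right} [cr right] := right; have {left_} [cl left_] := left_.
pose BL (c : R * R) := branch f (ad (- p)) (- s0) p sgp (- c.1, c.2).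
pose BR (c : R * R) := branch H (ad (- q)) s0 (- q) sgq c.
apply: (@has_card_ext _ (fun c => BL c \/ BR c)); last apply: (@has_cardU _ BL BR 1 1).
- move=> [s w]; split=> /=.
    case=> [[] [/= h1 h2 h3 h4]|[] [/= h1 h2 h3 h4]].
    + by apply: Or31; split=> //=; [lra|lra|rewrite -h4 fE opprK].
    + by apply: Or32; split=> //=; [lra|rewrite -h4 fE].
    + by apply: Or31; split=> //=; exact: le_lt_trans h1.
    + by apply: Or33; split.
  case=> /= -[h1 h2 h3 h4].
  + have [ss0|ss0|sE] := ltgtP s s0.
    * by left; left; split=> //=; [lra|lra|rewrite fE opprK].
    * by right; left; split.
    * by move: H1; rewrite -sE h4 ltxx.
  + by left; right; split=> //=; [rewrite h1 opprK|rewrite fE].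
  + by right; right; split.
- apply: (@has_card1 _ _ (- cl.1, cl.2)) => -[s w]; rewrite /BL left_; split.
    by move=> <- /=; rewrite opprK.
  by case=> -> ->; rewrite opprK; case: (cl).
- exact: has_card1 right.
- by move=> [s w] /= [[]/= ? ? ? ?|[]/= ? ? ? ?] [[]/= ? ? ? ?|[]/= ? ? ? ?]; lra.
Qed.
End MiddleGroup.

(** * The complete count of solutions *)

Section Codes.
Variable R : realType.

(** The equality case is recorded so that three weak comparisons add up to a strict one once some
    numerator is nonzero. *)
Lemma invsq_term_le (e p s t : R) : 0 <= e -> s < t -> p + t <= 0 ->
  (e != 0 -> p + t != 0) -> e / (p + s) ^+ 2 <= e / (p + t) ^+ 2 ?= iff (e == 0).
Proof.
move=> e0 s_t pt; have [->|en /(_ isT) ptn] := eqVneq e 0.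
  by move=> _; rewrite !mul0r; split; rewrite ?lexx ?eqxx.
have ep : 0 < e by rewrite lt_neqAle eq_sym en.
have ptl : p + t < 0 by rewrite lt_neqAle ptn.
suff h : e / (p + s) ^+ 2 < e / (p + t) ^+ 2 by split; [exact: ltW|exact: lt_eqF].
rewrite ltr_pM2l// ltf_pV2 ?posrE ?exprn_even_gt0//=; last lra.
by rewrite -[_ ^+ 2]sqrrN -[ltRHS]sqrrN ltr_pXn2r// ?nnegrE; lra.
Qed.

Lemma invsq_incr_low (p q r x y z s t : R) : q < p -> r < q ->
  0 <= x -> 0 <= y -> 0 <= z -> 0 < x + y + z -> s < t -> t <= - p ->
  admissible p q r x y z t -> invsq p q r x y z s < invsq p q r x y z t.
Proof.
move=> qp rq x0 y0 z0 nz s_t tp [xt yt zt].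
have [Lx Ex] := @invsq_term_le x p s t x0 s_t ltac:(lra) xt.
have [Ly Ey] := @invsq_term_le y q s t y0 s_t ltac:(lra) yt.
have [Lz Ez] := @invsq_term_le z r s t z0 s_t ltac:(lra) zt.
rewrite /invsq lt_neqAle !lerD// andbT; apply/negP => /eqP eqs.
have eqx : x / (p + s) ^+ 2 == x / (p + t) ^+ 2 by apply/eqP; lra.
have eqy : y / (q + s) ^+ 2 == y / (q + t) ^+ 2 by apply/eqP; lra.
have eqz : z / (r + s) ^+ 2 == z / (r + t) ^+ 2 by apply/eqP; lra.
move: eqx eqy eqz nz; rewrite Ex Ey Ez => /eqP-> /eqP-> /eqP->.
by rewrite !addr0 ltxx.
Qed.

Variables p q r x y z : R.
Hypotheses (qp : q < p) (rq : r < q).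
Hypotheses (x0 : 0 <= x) (y0 : 0 <= y) (z0 : 0 <= z) (nz : 0 < x + y + z).
Local Notation H := (invsq p q r x y z).
Local Notation ad := (admissible p q r x y z).

Local Ltac import_hyps :=
  have ? := qp; have ? := rq; have ? := x0; have ? := y0; have ? := z0;
  have ? := nz.

Lemma invsq_decr_high s t : s < t -> - r <= s -> ad s -> H t < H s.
Proof.
import_hyps; move=> s_t rs ads; rewrite -(invsq_opp _ _ _ _ _ _ s) -invsq_opp.
apply: invsq_incr_low; rewrite ?admissible_opp//; lra.
Qed.

(* [(s, w)] encodes a foot: [w] is the free coordinate when [s] is a removable pole. *)
Definition is_code (c : R * R) := [/\ ad c.1, H c.1 + c.2 ^+ 2 = 1 &
  c.1 != - p -> c.1 != - q -> c.1 != - r -> c.2 = 0].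

Definition low_group (c : R * R) :=
  [/\ c.1 < - p, c.2 = 0 & H c.1 = 1] \/
  [/\ c.1 = - p, ad (- p), c.2 < 0 & H (- p) + c.2 ^+ 2 = 1].

Lemma low_group_count : (ad (- p) -> H (- p) != 1) -> has_card low_group 1.
Proof.
import_hyps; move=> adp1.
have adl s : s < - p -> ad s by move=> sp; split=> _; apply: ltr0_neq0; lra.
(* With [m = x + y + z], this point is at distance at least [1 + m] from every pole, so
   [H t0 <= m / (1 + m) ^+ 2 < 1]. *)
pose t0 := - p - 1 - (x + y + z).
have incr s t : s < t -> t <= - p -> ad t -> H s < H t by exact: invsq_incr_low.
have t0p : t0 < - p by rewrite /t0; lra.
have Ht0 : H t0 < 1.
  have big v e : 0 <= e -> v <= p -> e / (v + t0) ^+ 2 <= e / (1 + (x + y + z)) ^+ 2.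
    move=> e0 vp; have vt : v + t0 <= - (1 + (x + y + z)) by rewrite /t0; lra.
    rewrite ler_wpM2l// lef_pV2 ?posrE ?exprn_even_gt0//=; try lra.
    by rewrite -[leRHS]sqrrN ler_pXn2r// ?nnegrE; lra.
  apply: (@le_lt_trans _ _ ((x + y + z) / (1 + (x + y + z)) ^+ 2)).
    by rewrite /invsq !mulrDl !lerD//; apply: big => //; lra.
  by rewrite ltr_pdivrMr ?exprn_gt0//; nra.
have [|||||c0 c0P] := @branch_unique R H (ad (- p)) t0 (- p) (- 1) _ (ltW t0p) Ht0.
- by rewrite sqrrN expr1n.
- by move=> s t _ s_t tp; apply: incr => //; [exact: ltW|exact: adl].
- by move=> s _ sp; apply: invsq_continuous; exact: adl.
- move=> adp; split; [exact: adp1|exact: invsq_continuous|].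
  by move=> s _ sp; exact: incr.
- move=> nadp.
  have xn : x != 0.
    apply: contra_notN nadp => /eqP xE.
    by split=> [|_|_]; rewrite ?xE ?eqxx//; lra.
  have xp : 0 < x by rewrite lt_neqAle eq_sym xn.
  have d0 : 0 < - p - t0 by rewrite subr_gt0.
  have [k /andP[k0 kd] k1] := large_near_pole xp d0.
  exists (- p - k); split; [lra|lra|].
  apply: (lt_le_trans k1); rewrite /invsq (_ : p + (- p - k) = - k); last by ring.
  by rewrite sqrrN -addrA lerDl addr_ge0// divr_ge0// sqr_ge0.
apply: (@has_card1 _ _ c0) => -[s w]; rewrite -c0P; split=> -[] [/=].
- move=> sp w0 Hs; left; split=> //=.
  rewrite ltNge; apply/negP; rewrite le_eqVlt => /predU1P[sE|st0].
    by move: Ht0; rewrite -sE Hs ltxx.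
  by have := lt_trans (incr _ _ st0 (ltW t0p) (adl _ t0p)) Ht0; rewrite Hs ltxx.
- by move=> -> adp w0 Hs; right; split=> //=; rewrite mulN1r oppr_gt0.
- by move=> _ sp w0 Hs; left.
- by move=> -> adp w0 Hs; right; split=> //=; rewrite mulN1r oppr_gt0 in w0.
Qed.

(* The signs [1, 1] at [-p, -q], [1, -1] at [-r, -q] and the negative sign at [-p] in
   [low_group] attach each foot above a removable pole to exactly one group. *)
Definition group1 := middle_group p q r x y z 1 1.
Definition group2 (c : R * R) :=
  middle_group (- r) (- q) (- p) z y x 1 (- 1) (- c.1, c.2).

Lemma group2_count n : has_card (middle_group (- r) (- q) (- p) z y x 1 (- 1)) n ->
  has_card group2 n.
Proof.
apply: (@has_card_image _ _ (fun c : R * R => (- c.1, c.2))).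
  by move=> [s w] [s' w'] _ _ [] /oppr_inj -> ->.
move=> [s w]; split=> [h|[[s' w']] h [-> ->]]; last by rewrite /group2 /= opprK.
by exists (- s, w) => //; rewrite /= opprK.
Qed.

(** The final 2 stands for the solution of [low_group] and for the root 0, the only one beyond [-r]
    since [H] decreases there. No solution sits at [-r]: if that pole is removable, then
    [H (- r) > H 0 = 1]. *)
Lemma code_count n1 n2 : 0 < r -> H 0 = 1 ->
  (ad (- p) -> H (- p) != 1) -> (ad (- q) -> H (- q) != 1) ->
  has_card group1 n1 -> has_card group2 n2 -> has_card is_code (n1 + n2 + 2)%N.
Proof.
import_hyps; move=> r0 H0 adp1 adq1 G1 G2.
have ad0 : ad 0 by split=> _; apply: lt0r_neq0; lra.
have G0 := low_group_count adp1.
have G3 : has_card (fun c : R * R => c = (0, 0)) 1 by apply: (@has_card1 _ _ (0, 0)).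
have nor w : ad (- r) -> H (- r) + w ^+ 2 <> 1.
  move=> adr E; have := @invsq_decr_high (- r) 0 ltac:(lra) (lexx _) adr.
  by rewrite H0 -E ltNge lerDl sqr_ge0.
have sq0 s w : H s != 1 -> H s + w ^+ 2 = 1 -> w != 0.
  by move=> Hs; apply: contra_eq_neq => ->; rewrite expr0n addr0.
have opp1 (e : R) : 0 < - 1 * e -> e < 0 by rewrite mulN1r oppr_gt0.
have HN s : invsq (- r) (- q) (- p) z y x (- s) = H s by exact: invsq_opp.
have adN s : admissible (- r) (- q) (- p) z y x (- s) = ad s.
  by apply/propext; exact: admissible_opp.
have g2E s w : group2 (s, w) <->
  [\/ [/\ - q < s, s < - r, w = 0 & H s = 1] |
      [/\ s = - q, ad (- q), w < 0 & H (- q) + w ^+ 2 = 1]].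
  rewrite /group2 /middle_group /= !HN !adN !opprK; split.
    case=> -[].
    - by move=> sr qs w0; move=> Hs; left; split=> //; lra.
    - by move=> sr adr _ /(nor _ adr).
    - by move=> sq adq /opp1 w0 Hq; right; split=> //; lra.
  case=> -[].
  - by move=> qs sr w0 Hs; apply: Or31; split=> //; lra.
  - by move=> sq adq w0 Hq; apply: Or33; split=> //; lra.
rewrite (_ : (n1 + n2 + 2 = n1 + n2 + 1 + 1)%N); last by rewrite -(addnA _ 1 1).
have D3 c : (group1 c \/ group2 c) \/ low_group c -> c = (0, 0) -> False.
  case: c => s w; rewrite g2E => h1 [sE wE]; rewrite {}sE {}wE in h1.
  by case: h1 => [[]|] h1; case: h1 => -[/=] h11 h12 h13; lra.
have D2 c : group1 c \/ group2 c -> low_group c -> False.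
  case: c => s w; rewrite g2E => h1 h2.
  case: h2 => -[/=] h21 h22 h23; case: h1 => h1; case: h1 => -[/=] h11 h12 h13 h14; lra.
have D1 c : group1 c -> group2 c -> False.
  case: c => s w; rewrite g2E => h1 h2.
  case: h1 => -[/=] h11 h12 h13 h14; case: h2 => -[/=] h21 h22 h23 h24; lra.
apply: has_card_ext (has_cardU (has_cardU (has_cardU G1 G2 D1) G0 D2) G3 D3).
move=> [s w]; rewrite g2E; split.
    case=> [[[|]|]|].
    + case=> -[/=].
      * by move=> ps sq -> Hs; split=> //=; [exact: admissible_inside|rewrite Hs expr0n addr0].
      * by move=> -> adp _ Hp; split=> //=; rewrite eqxx.
      * by move=> -> adp _ Hp; split=> //=; rewrite eqxx.
    + case=> -[/=].
      * move=> ps sq -> Hs; split=> //=; last by rewrite Hs expr0n addr0.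
        by split=> _; [apply: lt0r_neq0|apply: lt0r_neq0|apply: ltr0_neq0]; lra.
      * by move=> -> adp _ Hp; split=> //=; rewrite eqxx.
    + case=> -[/=].
      * move=> sp -> Hs; split=> //=; last by rewrite Hs expr0n addr0.
        by split=> _; apply: ltr0_neq0; lra.
      * by move=> -> adp _ Hp; split=> //=; rewrite eqxx.
    + by case=> -> ->; split=> //=; rewrite H0 expr0n addr0.
  case=> /= ads Hs nw.
  have [sp|sp|sE] := ltgtP s (- p); last first.
  + rewrite sE in ads Hs *; have /lt_total/orP[w0|w0] := sq0 _ _ (adp1 ads) Hs.
      by left; right; right.
    by left; left; left; apply: Or32; split=> //=; rewrite mul1r.
  + have [sq|sq|sE] := ltgtP s (- q); last first.
    * rewrite sE in ads Hs *; have /lt_total/orP[w0|w0] := sq0 _ _ (adq1 ads) Hs.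
        by left; left; right; right.
      by left; left; left; apply: Or33; split=> //=; rewrite mul1r.
    * have [sr|sr|sE] := ltgtP s (- r); last first.
      - by rewrite sE in ads Hs; case: (nor _ ads Hs).
      - have w0 : w = 0 by apply: nw; apply/eqP => ?; lra.
        right; rewrite w0; congr (_, _); move: Hs; rewrite w0 expr0n addr0 -H0 => Hs.
        have [s0|s0|//] := ltgtP s 0.
          by have := invsq_decr_high s0 (ltW sr) ads; rewrite Hs ltxx.
        by have := invsq_decr_high s0 ltac:(lra) ad0; rewrite Hs ltxx.
      - have w0 : w = 0 by apply: nw; apply/eqP => ?; lra.
        left; left; right; left; split=> //.
        by move: Hs; rewrite w0 expr0n addr0.
    * have w0 : w = 0 by apply: nw; apply/eqP => ?; lra.
      left; left; left; apply: Or31; split=> //=.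
      by move: Hs; rewrite w0 expr0n addr0.
  + have w0 : w = 0 by apply: nw; apply/eqP => ?; lra.
    left; right; left; split=> //=.
    by move: Hs; rewrite w0 expr0n addr0.
Qed.

End Codes.

(** * Extrema of a diagonal form on a plane *)

Section QuadraticForms.
Variable R : realType.

Definition diag3 (d1 d2 d3 v1 v2 v3 : R) := d1 * v1 ^+ 2 + d2 * v2 ^+ 2 + d3 * v3 ^+ 2.

(** The plane equation gives [v1 * n1], whose square is bounded by Cauchy-Schwarz with weights [d2]
    and [d3]. If [d2 = 0], the condition [n2 = 0] removes the second axis from that bound. *)
Lemma diag3_ge0 (d1 d2 d3 n1 n2 n3 v1 v2 v3 : R) :
  d1 < 0 -> 0 <= d2 -> 0 < d3 -> (d2 = 0 -> n2 = 0) -> n1 != 0 ->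
  n1 ^+ 2 / d1 + n2 ^+ 2 / d2 + n3 ^+ 2 / d3 <= 0 ->
  v1 * n1 + v2 * n2 + v3 * n3 = 0 -> 0 <= diag3 d1 d2 d3 v1 v2 v3.
Proof.
move=> d1n d2p d3p d2n n1n nd vn.
have CS : (v2 * n2 + v3 * n3) ^+ 2 <=
    (n2 ^+ 2 / d2 + n3 ^+ 2 / d3) * (d2 * v2 ^+ 2 + d3 * v3 ^+ 2).
  have [d2E|d2E] := eqVneq d2 0.
    rewrite (d2n d2E) d2E expr0n /= !(mulr0, mul0r) !add0r le_eqVlt; apply/orP; left.
    by apply/eqP; field; rewrite gt_eqF.
  have d2p' : 0 < d2 by rewrite lt_neqAle eq_sym d2E.
  rewrite -subr_ge0.
  have -> : (n2 ^+ 2 / d2 + n3 ^+ 2 / d3) * (d2 * v2 ^+ 2 + d3 * v3 ^+ 2) -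
     (v2 * n2 + v3 * n3) ^+ 2 = (n2 * v3 * d3 - n3 * v2 * d2) ^+ 2 / (d2 * d3).
    by field; rewrite (gt_eqF d3p) d2E.
  by rewrite divr_ge0 ?sqr_ge0// mulr_ge0// ltW.
have E1 : (v2 * n2 + v3 * n3) ^+ 2 = v1 ^+ 2 * n1 ^+ 2.
  by rewrite (_ : v2 * n2 + v3 * n3 = - (v1 * n1)) ?sqrrN ?exprMn//; lra.
have S0 : 0 <= d2 * v2 ^+ 2 + d3 * v3 ^+ 2.
  by rewrite addr_ge0// mulr_ge0 ?sqr_ge0// ltW.
have n1p : 0 < n1 ^+ 2 by rewrite exprn_even_gt0.
have L : v1 ^+ 2 * n1 ^+ 2 <= n1 ^+ 2 / (- d1) * (d2 * v2 ^+ 2 + d3 * v3 ^+ 2).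
  rewrite -E1; apply: (le_trans CS); rewrite ler_wpM2r//.
  by move: nd; rewrite invrN mulrN; lra.
move: L; rewrite [leLHS]mulrC -mulrA ler_pM2l// [leRHS]mulrC ler_pdivlMr ?oppr_gt0//.
by rewrite /diag3; lra.
Qed.

(** Lagrange multipliers: at a minimum on the plane the gradient is normal to the plane, so
    [v_i = nu * n_i / d_i], and substituting this in the plane equation gives the conclusion. *)
Lemma diag3_lagrange (d1 d2 d3 n1 n2 n3 v1 v2 v3 : R) :
  d1 != 0 -> d2 != 0 -> d3 != 0 -> n1 != 0 -> 0 < v1 ^+ 2 + v2 ^+ 2 + v3 ^+ 2 ->
  v1 * n1 + v2 * n2 + v3 * n3 = 0 -> diag3 d1 d2 d3 v1 v2 v3 = 0 ->
  (forall w1 w2 w3, w1 * n1 + w2 * n2 + w3 * n3 = 0 -> 0 <= diag3 d1 d2 d3 w1 w2 w3) ->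
  n1 ^+ 2 / d1 + n2 ^+ 2 / d2 + n3 ^+ 2 / d3 = 0.
Proof.
move=> d1n d2n d3n n1n vp vn v0 minv.
have L0 w1 w2 w3 : w1 * n1 + w2 * n2 + w3 * n3 = 0 ->
    d1 * v1 * w1 + d2 * v2 * w2 + d3 * v3 * w3 = 0.
  move=> wn; set L := (X in X = 0); apply/eqP; apply: contraT => Ln.
  have Lp : 0 < L ^+ 2 by rewrite exprn_even_gt0.
  (* Moving [v] by [- t * L] along [w] changes the form by [- t * L ^+ 2 * (2 - t * M)]; this choice
     of [t] ensures [t * M < 1], so the form would become negative. *)
  pose M := diag3 d1 d2 d3 w1 w2 w3; pose t := (1 + M ^+ 2)^-1.
  have t0 : 0 < t by rewrite invr_gt0 ltr_pwDl// sqr_ge0.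
  have tM : t * M < 1.
    rewrite mulrC ltr_pdivrMr ?mul1r; last by rewrite ltr_pwDl// sqr_ge0.
    by nra.
  have := minv (v1 - t * L * w1) (v2 - t * L * w2) (v3 - t * L * w3).
  have -> : diag3 d1 d2 d3 (v1 - t * L * w1) (v2 - t * L * w2) (v3 - t * L * w3) =
     diag3 d1 d2 d3 v1 v2 v3 - t * L ^+ 2 * (2 - t * M) by rewrite /M /L /diag3; ring.
  rewrite v0 sub0r => /(_ _)/wrap[].
    have -> : (v1 - t * L * w1) * n1 + (v2 - t * L * w2) * n2 + (v3 - t * L * w3) * n3 =
      (v1 * n1 + v2 * n2 + v3 * n3) - t * L * (w1 * n1 + w2 * n2 + w3 * n3) by ring.
    by rewrite vn wn mulr0 subr0.
  have : 0 < t * L ^+ 2 * (2 - t * M).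
    by apply: mulr_gt0; [exact: mulr_gt0|lra].
  by lra.
have nn : 0 < n1 ^+ 2 + n2 ^+ 2 + n3 ^+ 2.
  by rewrite -addrA ltr_pwDl ?exprn_even_gt0// addr_ge0 ?sqr_ge0.
(* The multiplier: [w] is the projection of the half gradient on the plane, and [L0] applied to [w]
   shows that its norm is 0. *)
pose nu := (d1 * v1 * n1 + d2 * v2 * n2 + d3 * v3 * n3) / (n1 ^+ 2 + n2 ^+ 2 + n3 ^+ 2).
pose w1 := d1 * v1 - nu * n1; pose w2 := d2 * v2 - nu * n2.
pose w3 := d3 * v3 - nu * n3.
have wn : w1 * n1 + w2 * n2 + w3 * n3 = 0.
  by rewrite /w1 /w2 /w3 /nu; field; rewrite gt_eqF.
have w0 : w1 ^+ 2 + w2 ^+ 2 + w3 ^+ 2 = 0.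
  transitivity ((d1 * v1 * w1 + d2 * v2 * w2 + d3 * v3 * w3) -
     nu * (w1 * n1 + w2 * n2 + w3 * n3)); first by rewrite /w1 /w2 /w3; ring.
  by rewrite L0// wn mulr0 subr0.
have w1E : w1 = 0.
  by apply/eqP; rewrite -sqrf_eq0; apply/eqP;
    have := sqr_ge0 w1; have := sqr_ge0 w2; have := sqr_ge0 w3; lra.
have w2E : w2 = 0.
  by apply/eqP; rewrite -sqrf_eq0; apply/eqP;
    have := sqr_ge0 w1; have := sqr_ge0 w2; have := sqr_ge0 w3; lra.
have w3E : w3 = 0.
  by apply/eqP; rewrite -sqrf_eq0; apply/eqP;
    have := sqr_ge0 w1; have := sqr_ge0 w2; have := sqr_ge0 w3; lra.
have v1E : v1 = nu * (n1 / d1).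
  by apply: (mulfI d1n); rewrite mulrCA (mulrCA d1) divff// mulr1; move: w1E; rewrite /w1; lra.
have v2E : v2 = nu * (n2 / d2).
  by apply: (mulfI d2n); rewrite mulrCA (mulrCA d2) divff// mulr1; move: w2E; rewrite /w2; lra.
have v3E : v3 = nu * (n3 / d3).
  by apply: (mulfI d3n); rewrite mulrCA (mulrCA d3) divff// mulr1; move: w3E; rewrite /w3; lra.
have nun : nu != 0.
  by apply: contraTneq vp => nu0; rewrite v1E v2E v3E nu0 !mul0r expr0n /= !addr0 ltxx.
apply: (mulfI nun); rewrite mulr0 -[RHS]vn v1E v2E v3E; ring.
Qed.

(* [D1, D2, D3] is, up to a positive factor, the diagonal of the second fundamental
   form shifted by the principal curvature attached to [s0]. *)
Lemma stationary_diag3 (p q r x y z s0 ka w1 w2 w3 n1 n2 n3 : R) :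
  q < p -> r < q -> 0 <= x -> 0 <= y -> 0 <= z -> 0 < x + y + z ->
  0 < ka -> 0 < w1 -> 0 < w2 -> 0 < w3 ->
  n1 ^+ 2 = ka * w1 * (x / (p + s0) ^+ 2) -> n2 ^+ 2 = ka * w2 * (y / (q + s0) ^+ 2) ->
  n3 ^+ 2 = ka * w3 * (z / (r + s0) ^+ 2) ->
  stationary p q r x y z s0 ->
  let D1 := - (w1 * (p + s0)) in let D2 := - (w2 * (q + s0)) in
  let D3 := - (w3 * (r + s0)) in
  (exists v1 v2 v3, [/\ 0 < v1 ^+ 2 + v2 ^+ 2 + v3 ^+ 2,
     v1 * n1 + v2 * n2 + v3 * n3 = 0 & diag3 D1 D2 D3 v1 v2 v3 = 0]) /\
  (forall v1 v2 v3, v1 * n1 + v2 * n2 + v3 * n3 = 0 -> 0 <= diag3 D1 D2 D3 v1 v2 v3).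
Proof.
move=> qp rq x0 y0 z0 nz ka0 w1p w2p w3p n1E n2E n3E [ps0 s0q [xs ys zs] dr dl] D1 D2 D3.
have D2p : 0 <= D2 by rewrite /D2 oppr_ge0 mulr_ge0_le0//; lra.
have D3p : 0 < D3 by rewrite /D3 oppr_gt0 pmulr_rlt0//; lra.
have nDE n w e k : 0 < w -> n ^+ 2 = ka * w * (e / k ^+ 2) ->
    n ^+ 2 / - (w * k) = - ka * (e / k ^+ 3).
  move=> wp ->; have [->|kn] := eqVneq k 0.
    by rewrite mulr0 oppr0 !expr0n /= !invr0 !mulr0.
  by field; rewrite kn gt_eqF.
have nD : n1 ^+ 2 / D1 + n2 ^+ 2 / D2 + n3 ^+ 2 / D3 = - ka * invcube p q r x y z s0.
  by rewrite /D1 /D2 /D3 (nDE _ _ _ _ w1p n1E) (nDE _ _ _ _ w2p n2E)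
    (nDE _ _ _ _ w3p n3E) /invcube -!mulrDr.
(* At an end of the interval a diagonal entry and the matching normal coordinate vanish together, so
   that axis is itself a null direction. *)
have [s0E|s0p] := eqVneq s0 (- p).
  have n10 : n1 = 0.
    by apply/eqP; rewrite -sqrf_eq0 n1E s0E subrr expr0n /= invr0 !mulr0.
  have D10 : D1 = 0 by rewrite /D1 s0E subrr mulr0 oppr0.
  split; last first.
    by move=> v1 v2 v3 _; rewrite /diag3 D10 mul0r add0r addr_ge0// mulr_ge0 ?sqr_ge0// ltW.
  exists 1, 0, 0; rewrite /diag3 D10 n10 !expr0n /=; split.
  - by rewrite expr1n !addr0.
  - by ring.
  - by ring.
have {}ps0 : - p < s0 by rewrite lt_neqAle eq_sym s0p.
have D1n : D1 < 0 by rewrite /D1 oppr_lt0 mulr_gt0//; lra.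
have inv0 := dl ps0.
have neg_cube (k : R) : k <= 0 -> k ^+ 3 <= 0 by move=> ?; rewrite exprn_odd_le0.
have n1n : n1 != 0.
  rewrite -sqrf_eq0 n1E; apply/eqP => /eqP.
  rewrite !mulf_eq0 gt_eqF//= gt_eqF//= => /orP xE.
  have {}xE : x = 0.
    case: xE => [/eqP//|]; rewrite invr_eq0 expf_eq0 /= => /eqP; lra.
  have yc : y / (q + s0) ^+ 3 <= 0 by rewrite mulr_ge0_le0// invr_le0 neg_cube//; lra.
  have zc : z / (r + s0) ^+ 3 <= 0 by rewrite mulr_ge0_le0// invr_le0 neg_cube//; lra.
  move: inv0; rewrite /invcube xE mul0r add0r => inv0.
  have yE : y = 0.
    apply/eqP; apply: contraT => yn; have : y / (q + s0) ^+ 3 == 0 by apply/eqP; lra.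
    by rewrite mulf_eq0 (negPf yn) invr_eq0 expf_eq0 /= (negPf (ys yn)).
  have zE : z = 0.
    apply/eqP; apply: contraT => zn; have : z / (r + s0) ^+ 3 == 0 by apply/eqP; lra.
    by rewrite mulf_eq0 (negPf zn) invr_eq0 expf_eq0 /= (negPf (zs zn)).
  by lra.
have D2n : D2 = 0 -> n2 = 0.
  move=> /eqP; rewrite oppr_eq0 mulf_eq0 gt_eqF//= => /eqP qs.
  by apply/eqP; rewrite -sqrf_eq0 n2E qs expr0n /= invr0 !mulr0.
split; last first.
  move=> v1 v2 v3; apply: diag3_ge0 => //.
  by rewrite nD mulr_le0_ge0// oppr_le0 ltW.
have [s0E|s0q'] := eqVneq s0 (- q).
  have D20 : D2 = 0 by rewrite /D2 s0E subrr mulr0 oppr0.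
  exists 0, 1, 0; rewrite /diag3 D20 (D2n D20) !expr0n /=; split.
  - by rewrite expr1n addr0 add0r.
  - by ring.
  - by ring.
have {}s0q : s0 < - q by rewrite lt_neqAle s0q'.
have D2n' : D2 != 0.
  by rewrite oppr_eq0 mulf_neq0 ?(gt_eqF w2p)//; apply: ltr0_neq0; lra.
have D1n' : D1 != 0 by rewrite lt_eqF.
have D3n' : D3 != 0 by rewrite gt_eqF.
have inv00 : invcube p q r x y z s0 = 0 by apply/eqP; rewrite eq_le inv0 dr.
(* The critical vector given by Lagrange multipliers: its orthogonality to [n] and the vanishing of
   the form both reduce to [nD]. *)
exists (n1 / D1), (n2 / D2), (n3 / D3); split.
- rewrite -addrA ltr_pwDl ?addr_ge0 ?sqr_ge0//.
  by rewrite exprn_even_gt0//= mulf_neq0// invr_eq0.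
- by transitivity (n1 ^+ 2 / D1 + n2 ^+ 2 / D2 + n3 ^+ 2 / D3); [ring|rewrite nD inv00 mulr0].
- transitivity (n1 ^+ 2 / D1 + n2 ^+ 2 / D2 + n3 ^+ 2 / D3).
    by rewrite /diag3; field; rewrite D1n' D2n' D3n'.
  by rewrite nD inv00 mulr0.
Qed.

End QuadraticForms.

(** * Regions separated by a closed surface *)

Section Regions.
Variable R : realType.
Implicit Types (S I O C : set (R * R * R)) (A : R * R * R).

Lemma px_continuous : continuous (@px R).
Proof.
by move=> p; apply: (@cvg_comp _ _ _ fst fst _ (nbhs p.1)); exact: cvg_fst.
Qed.

Lemma py_continuous : continuous (@py R).
Proof.
move=> p; apply: (@cvg_comp _ _ _ fst snd _ (nbhs p.1)); [exact: cvg_fst|exact: cvg_snd].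
Qed.

Lemma pz_continuous : continuous (@pz R).
Proof. by move=> p; exact: cvg_snd. Qed.

Lemma triple_continuous (T : topologicalType) (f g h : T -> R) :
  continuous f -> continuous g -> continuous h ->
  continuous (fun t => (f t, g t, h t)).
Proof.
by move=> cf cg ch t; exact: (cvg_pair (cvg_pair (cf t) (cg t)) (ch t)).
Qed.

(** The trace of [I] on [C] is open, and also closed because it is the trace of the complement of
    [O]. *)
Lemma connected_in_region S I O C A : open I -> open O ->
  (forall x, I x -> O x -> False) -> (forall x, [\/ I x, S x | O x]) ->
  connected C -> C `<=` ~` S -> C A -> I A -> C `<=` I.
Proof.
move=> oI oO IO cover cC CS CA IA.
suff <- : C `&` I = C by apply: subIsetr.
apply: cC.
- by exists A.
- by exists I.
- exists (~` O); first exact: open_closedC.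
  apply/seteqP; split=> x [Cx]; first by move=> Ix; split=> // /(IO _ Ix).
  by move=> nOx; split=> //; case: (cover x) => // Sx; case: (CS _ Cx).
Qed.

Definition scale3 (l : R) A := (l * px A, l * py A, l * pz A).

Lemma ray_connected A : connected [set scale3 l A | l in `[1, +oo[].
Proof.
apply: connected_continuous_connected.
  by apply/connected_intervalP; exact: interval_is_interval.
apply: continuous_subspaceT.
have cM (k : R) : continuous (fun l : R => l * k) by move=> l; exact: mulrr_continuous.
exact: triple_continuous.
Qed.

Lemma ray_unbounded A (M : R) : (px A, py A, pz A) != (0, 0, 0) ->
  exists2 l, 1 <= l & ~ (`|l * px A| <= M /\ `|l * py A| <= M /\ `|l * pz A| <= M).
Proof.
have key (x : R) : x != 0 -> exists2 l, 1 <= l & M < `|l * x|.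
  move=> xn; have xp : 0 < `|x| by rewrite normr_gt0.
  have q0 : 0 <= (`|M| + 1) / `|x| by rewrite divr_ge0// addr_ge0.
  exists (1 + (`|M| + 1) / `|x|); first by rewrite lerDl.
  rewrite normrM [`|1 + _|]ger0_norm ?addr_ge0// mulrDl divfK ?gt_eqF// mul1r.
  by have := ler_norm M; lra.
have [x0|/key[l l1 Ml] _] := eqVneq (px A) 0; last first.
  by exists l => // -[]; rewrite leNgt Ml.
have [y0|/key[l l1 Ml] _] := eqVneq (py A) 0; last first.
  by exists l => // -[_ []]; rewrite leNgt Ml.
have [z0|/key[l l1 Ml] _] := eqVneq (pz A) 0; last first.
  by exists l => // -[_ [_]]; rewrite leNgt Ml.
by rewrite x0 y0 z0 eqxx.
Qed.

(** A component meeting [I] stays in the bounded set [I]. A point of [O] differs from the origin and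
    has its whole outward ray in [O], so its component is unbounded. *)
Lemma inside_region S I O : open I -> open O ->
  (forall x, I x -> O x -> False) -> (forall x, [\/ I x, S x | O x]) ->
  (forall x, O x -> ~ S x) -> bounded3 I -> ~ O (0, 0, 0) ->
  (forall l A, 1 <= l -> O A -> O (scale3 l A)) ->
  forall A, ~ S A -> (inside S A <-> I A).
Proof.
move=> oI oO IO cover OS [M IM] O0 Oray A nSA; split; last first.
  move=> IA; split=> //; exists M => p.
  case=> C [CA CS cC] Cp; apply: IM.
  exact: (connected_in_region oI oO IO cover cC CS CA IA).
case=> _ [K KM]; case: (cover A) => // OA; exfalso.
have An0 : (px A, py A, pz A) != (0, 0, 0).
  by apply/eqP => E; apply: O0; rewrite -E; case: (A) OA => [[]].
have [l l1 lK] := ray_unbounded K An0.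
apply: lK; apply: (KM (scale3 l A)).
apply: (@connected_component_max _ (~` S) [set scale3 l A | l in `[1, +oo[] A).
- by exists 1; rewrite /= ?in_itv /= ?lexx// /scale3 !mul1r; case: (A) => [[]].
- by move=> x [t]; rewrite /= in_itv /= andbT => t1 <-; apply: OS; exact: Oray.
- exact: ray_connected.
- by exists l => //=; rewrite in_itv /= l1.
Qed.

End Regions.

(** * The ellipsoid and its caustic *)

Section Caustic.
Variable R : realType.
Variables a b c : R.
Hypotheses (c_gt0 : 0 < c) (ltcb : c < b) (ltba : b < a).
Implicit Types (A B P : R * R * R) (s k w : R).

Local Notation al := (a ^+ 2).
Local Notation be := (b ^+ 2).
Local Notation ga := (c ^+ 2).

Let ga_gt0 : 0 < ga. Proof. by rewrite exprn_gt0. Qed.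
Let ltgb : ga < be.
Proof. by rewrite ltr_pXn2r ?nnegrE ?ltW// (lt_trans c_gt0). Qed.
Let ltba2 : be < al.
Proof. by rewrite ltr_pXn2r ?nnegrE ?ltW// (lt_trans c_gt0)// (lt_trans ltcb). Qed.
Let be_gt0 : 0 < be. Proof. exact: lt_trans ltgb. Qed.
Let al_gt0 : 0 < al. Proof. exact: lt_trans ltba2. Qed.
Let b_gt0 : 0 < b. Proof. exact: lt_trans ltcb. Qed.
Let a_gt0 : 0 < a. Proof. exact: lt_trans ltba. Qed.
Let ltNgb : - be < - ga. Proof. by rewrite ltrN2. Qed.
Let ltNba : - al < - be. Proof. by rewrite ltrN2. Qed.
Let coef_ge0 (v u : R) : 0 < v -> 0 <= v * u ^+ 2.
Proof. by move=> v0; rewrite mulr_ge0 ?sqr_ge0// ltW. Qed.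
Let coef_eq0 (v u : R) : 0 < v -> v * u ^+ 2 = 0 -> u = 0.
Proof. by move=> v0 /eqP; rewrite mulf_eq0 (gt_eqF v0) sqrf_eq0 => /eqP. Qed.
Let cx_ge0 A : 0 <= al * px A ^+ 2. Proof. exact: coef_ge0. Qed.
Let cy_ge0 A : 0 <= be * py A ^+ 2. Proof. exact: coef_ge0. Qed.
Let cz_ge0 A : 0 <= ga * pz A ^+ 2. Proof. exact: coef_ge0. Qed.

Local Ltac import_hyps := have ? := ga_gt0; have ? := ltgb; have ? := ltba2.

Definition footval A s :=
  invsq al be ga (al * px A ^+ 2) (be * py A ^+ 2) (ga * pz A ^+ 2) s.
Definition footadm A s :=
  admissible al be ga (al * px A ^+ 2) (be * py A ^+ 2) (ga * pz A ^+ 2) s.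

Definition normal_pt P s : R * R * R :=
  (px P + s * px (Nvec a b c P), py P + s * py (Nvec a b c P), pz P + s * pz (Nvec a b c P)).

(* [normN] times the second fundamental form minus the curvature [- 1 / (s normN)],
   whose center is the point of parameter [s] on the normal. *)
Local Notation shifted s := (diag3 (al^-1 + s^-1) (be^-1 + s^-1) (ga^-1 + s^-1)).

Definition tangent P (v1 v2 v3 : R) : Prop :=
  v1 * px (Nvec a b c P) + v2 * py (Nvec a b c P) + v3 * pz (Nvec a b c P) = 0.

Definition null_direction P s := exists v1 v2 v3 : R,
  [/\ 0 < v1 ^+ 2 + v2 ^+ 2 + v3 ^+ 2, tangent P v1 v2 v3 & shifted s v1 v2 v3 = 0].

(** * Principal curvatures and the sign of the shifted form *)

Lemma normN_gt0 P : onE a b c P -> 0 < normN a b c P.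
Proof.
case: P => [[x y] z]; rewrite /onE /normN /dot /Nvec /px /py /pz /= => E.
rewrite sqrtr_gt0 -!expr2 lt_neqAle !addr_ge0 ?sqr_ge0// andbT eq_sym.
apply/eqP => /eqP; rewrite paddr_eq0 ?addr_ge0 ?sqr_ge0// paddr_eq0 ?sqr_ge0//.
rewrite !sqrf_eq0 !mulf_eq0 !invr_eq0 !expf_eq0 /=.
rewrite !(gt_eqF (x := a)) ?(gt_eqF (x := b)) ?(gt_eqF c_gt0); last 2 first.
- exact: lt_trans ltcb.
- exact: lt_trans (lt_trans c_gt0 ltcb) ltba.
rewrite !orbF => /andP[/andP[/eqP x0 /eqP y0] /eqP z0].
by move: E; rewrite x0 y0 z0 expr0n /= !mul0r !addr0 => /esym/eqP; rewrite oner_eq0.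
Qed.

Lemma unit_tangentZ P (v1 v2 v3 : R) : onE a b c P ->
  0 < v1 ^+ 2 + v2 ^+ 2 + v3 ^+ 2 ->
  tangent P v1 v2 v3 ->
  exists2 v, unit_tangent a b c P v & normal_curv a b c P v =
    diag3 al^-1 be^-1 ga^-1 v1 v2 v3 / (v1 ^+ 2 + v2 ^+ 2 + v3 ^+ 2) / normN a b c P.
Proof.
move=> PE vp vN; set n2 := v1 ^+ 2 + v2 ^+ 2 + v3 ^+ 2 in vp *.
pose m := Num.sqrt n2.
have m2 : m ^+ 2 = n2 by rewrite sqr_sqrtr// ltW.
have m0 : m != 0 by rewrite gt_eqF// sqrtr_gt0.
have n20 : n2 != 0 by rewrite gt_eqF.
exists (v1 / m, v2 / m, v3 / m).
  split; rewrite /dot.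
    transitivity ((v1 * px (Nvec a b c P) + v2 * py (Nvec a b c P) + v3 * pz (Nvec a b c P)) / m).
      by rewrite /= /px /py /pz /=; ring.
    by rewrite vN mul0r.
  rewrite /= /px /py /pz /=.
  transitivity (n2 / m ^+ 2); first by rewrite /n2; field.
  by rewrite m2 divff.
rewrite /normal_curv /diag3 /px /py /pz /= !expr_div_n m2; congr (_ / _).
by ring.
Qed.

(** The curvature is [- s^-1 / normN a b c P]: the null direction shows that it is attained, the
    sign of the shifted form that it is minimal. *)
Lemma sheet1_intro P s : onE a b c P -> s < 0 ->
  null_direction P s ->
  (forall v1 v2 v3,
     tangent P v1 v2 v3 ->
     0 <= shifted s v1 v2 v3) ->
  sheet1 a b c (normal_pt P s).
Proof.
move=> PE s0 [v1 [v2 [v3 [vp vN v0]]]] minv.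
have Np := normN_gt0 PE; have Nn : normN a b c P != 0 by rewrite gt_eqF.
have sn : s != 0 by rewrite lt_eqF.
exists P, (- s^-1 / normN a b c P); split=> //; split; last first.
  rewrite /normal_pt /curv_center; congr (_, _, _); field; by rewrite sn Nn.
split.
  have [v uv vE] := unit_tangentZ PE vp vN; exists v; split=> //; rewrite vE; congr (_ / _).
  apply: (mulIf (lt0r_neq0 vp)); rewrite divfK ?gt_eqF//.
  by move: v0; rewrite /diag3; lra.
move=> [[u1 u2] u3] [uN u1E]; rewrite /normal_curv ler_pM2r ?invr_gt0//.
have := minv u1 u2 u3 uN; move: u1E.
rewrite /dot /diag3 /px /py /pz /= -!expr2 => u1E.
have : s^-1 * (u1 ^+ 2 + u2 ^+ 2 + u3 ^+ 2) = s^-1 by rewrite u1E mulr1.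
by lra.
Qed.

Lemma sheet2_intro P s : onE a b c P -> s < 0 ->
  null_direction P s ->
  (forall v1 v2 v3,
     tangent P v1 v2 v3 ->
     shifted s v1 v2 v3 <= 0) ->
  sheet2 a b c (normal_pt P s).
Proof.
move=> PE s0 [v1 [v2 [v3 [vp vN v0]]]] minv.
have Np := normN_gt0 PE; have Nn : normN a b c P != 0 by rewrite gt_eqF.
have sn : s != 0 by rewrite lt_eqF.
exists P, (- s^-1 / normN a b c P); split=> //; split; last first.
  rewrite /normal_pt /curv_center; congr (_, _, _); field; by rewrite sn Nn.
split.
  have [v uv vE] := unit_tangentZ PE vp vN; exists v; split=> //; rewrite vE; congr (_ / _).
  apply: (mulIf (lt0r_neq0 vp)); rewrite divfK ?gt_eqF//.
  by move: v0; rewrite /diag3; lra.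
move=> [[u1 u2] u3] [uN u1E]; rewrite /normal_curv ler_pM2r ?invr_gt0//.
have := minv u1 u2 u3 uN; move: u1E.
rewrite /dot /diag3 /px /py /pz /= -!expr2 => u1E.
have : s^-1 * (u1 ^+ 2 + u2 ^+ 2 + u3 ^+ 2) = s^-1 by rewrite u1E mulr1.
by lra.
Qed.

Let ltVab : al^-1 < be^-1. Proof. by rewrite ltf_pV2 ?posrE. Qed.
Let ltVbg : be^-1 < ga^-1. Proof. by rewrite ltf_pV2 ?posrE. Qed.
Let Va_gt0 : 0 < al^-1. Proof. by rewrite invr_gt0. Qed.

Let sqr_eq0_of_le0 (u : R) : u ^+ 2 <= 0 -> u = 0.
Proof. by move=> h; apply/eqP; rewrite -sqrf_eq0 eq_le h sqr_ge0. Qed.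

(** The sign [sg] treats both principal curvatures at once: 1 for the minimum, -1 for the maximum.
    The parameter is [- mu^-1] with [mu = k * normN a b c P], positive because it is at least
    [al^-1]. *)
Lemma principal_elim sg P k : sg ^+ 2 = 1 -> onE a b c P ->
  (exists v, unit_tangent a b c P v /\ normal_curv a b c P v = k) ->
  (forall v, unit_tangent a b c P v -> sg * k <= sg * normal_curv a b c P v) ->
  exists s, [/\ s < 0, - s^-1 = k * normN a b c P, curv_center a b c P k = normal_pt P s,
   null_direction P s &
   (forall v1 v2 v3,
     tangent P v1 v2 v3 ->
     0 <= sg * shifted s v1 v2 v3)].
Proof.
move=> sg2 PE [[[v1 v2] v3] [[vN v1E] vk]] kmin.
have Np := normN_gt0 PE; have Nn : normN a b c P != 0 by rewrite gt_eqF.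
have ? := Va_gt0; have ? := ltVab; have ? := ltVbg.
rewrite /dot /px /py /pz /= -!expr2 in v1E.
pose mu := diag3 al^-1 be^-1 ga^-1 v1 v2 v3.
have kE : k * normN a b c P = mu.
  by rewrite -vk /normal_curv divfK// /mu /diag3 /px /py /pz /=; ring.
have mu0 : 0 < mu.
  apply: (lt_le_trans Va_gt0); rewrite -[leLHS]mulr1 -v1E /mu /diag3 !mulrDr.
  by rewrite !lerD// ler_wpM2r ?sqr_ge0//; lra.
have k0 : k != 0 by apply: contraTneq mu0 => k0; rewrite -kE k0 mul0r ltxx.
exists (- mu^-1); split.
- by rewrite oppr_lt0 invr_gt0.
- by rewrite invrN invrK opprK kE.
- by rewrite /curv_center /normal_pt -kE; congr (_, _, _); field; rewrite k0 Nn.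
- exists v1, v2, v3; split; [by rewrite v1E|exact: vN|].
  rewrite invrN invrK; transitivity (mu - mu * (v1 ^+ 2 + v2 ^+ 2 + v3 ^+ 2)).
    by rewrite /mu /diag3; ring.
  by rewrite v1E mulr1 subrr.
move=> u1 u2 u3 uN; rewrite invrN invrK.
have [u0|up] := eqVneq (u1 ^+ 2 + u2 ^+ 2 + u3 ^+ 2) 0.
  have u10 : u1 ^+ 2 = 0 by have := sqr_ge0 u1; have := sqr_ge0 u2; have := sqr_ge0 u3; lra.
  have u20 : u2 ^+ 2 = 0 by have := sqr_ge0 u1; have := sqr_ge0 u2; have := sqr_ge0 u3; lra.
  have u30 : u3 ^+ 2 = 0 by have := sqr_ge0 u1; have := sqr_ge0 u2; have := sqr_ge0 u3; lra.
  by rewrite /diag3 u10 u20 u30 !mulr0 !addr0 mulr0.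
have {}up : 0 < u1 ^+ 2 + u2 ^+ 2 + u3 ^+ 2 by rewrite lt_neqAle eq_sym up !addr_ge0 ?sqr_ge0.
have [u uu uE] := unit_tangentZ PE up uN.
have -> : sg * diag3 (al^-1 - mu) (be^-1 - mu) (ga^-1 - mu) u1 u2 u3 =
    (sg * normal_curv a b c P u - sg * k) * (normN a b c P * (u1 ^+ 2 + u2 ^+ 2 + u3 ^+ 2)).
  have -> : sg * diag3 (al^-1 - mu) (be^-1 - mu) (ga^-1 - mu) u1 u2 u3 =
    sg * (diag3 al^-1 be^-1 ga^-1 u1 u2 u3 - mu * (u1 ^+ 2 + u2 ^+ 2 + u3 ^+ 2)).
    by rewrite /diag3; ring.
  rewrite uE -kE; move: (diag3 _ _ _ _ _ _) => Q; field.
  by rewrite Nn gt_eqF.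
by rewrite mulr_ge0 ?subr_ge0 ?kmin// mulr_ge0// ltW.
Qed.

(** A null direction prevents the least coefficient of the shifted form from being positive, whence
    [- al <= s]. The tangent plane contains a nonzero vector in the span of the first two axes,
    which forces the second coefficient to be nonnegative, whence [s <= - be]. *)
Lemma sheet1_elim A : sheet1 a b c A -> exists P s,
  [/\ onE a b c P, A = normal_pt P s, - al <= s, s <= - be & 
   null_direction P s /\
   (forall v1 v2 v3,
     tangent P v1 v2 v3 ->
     0 <= shifted s v1 v2 v3)].
Proof.
case=> P [k [PE [[kv kmin] ->]]].
have [||s [s0 sk AE vE minv]] := @principal_elim 1 P k _ PE kv; first by rewrite expr1n.
  by move=> v uv; rewrite !mul1r; exact: kmin.
have {}minv v1 v2 v3 : tangent P v1 v2 v3 ->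
     0 <= shifted s v1 v2 v3 by move=> /minv; rewrite mul1r.
have sn : s != 0 by rewrite lt_eqF.
have ? := Va_gt0; have ? := ltVab; have ? := ltVbg.
exists P, s; split=> //.
- have [v1 [v2 [v3 [vp _]]]] := vE; rewrite /diag3 => v0.
  have : al^-1 + s^-1 <= 0.
    rewrite leNgt; apply/negP => d1.
    have : 0 < (al^-1 + s^-1) * (v1 ^+ 2 + v2 ^+ 2 + v3 ^+ 2) by rewrite mulr_gt0.
    have : 0 <= (be^-1 - al^-1) * v2 ^+ 2 by rewrite mulr_ge0 ?sqr_ge0//; lra.
    have : 0 <= (ga^-1 - al^-1) * v3 ^+ 2 by rewrite mulr_ge0 ?sqr_ge0//; lra.
    by lra.
  rewrite -(opprK s^-1) -invrN subr_le0 lef_pV2 ?posrE ?oppr_gt0//; lra.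
- have : 0 <= be^-1 + s^-1.
    rewrite leNgt; apply/negP => d2.
    set n1 := px (Nvec a b c P); set n2 := py (Nvec a b c P).
    (* This tangent vector can only be zero if the coefficient is negative; the first axis is then
       tangent and gives the contradiction. *)
    have := minv n2 (- n1) 0; rewrite /tangent -/n1 -/n2 => /(_ ltac:(ring)).
    rewrite /diag3 expr0n /= mulr0 addr0 sqrrN => h.
    have h1 := sqr_ge0 n1; have h2 := sqr_ge0 n2.
    have n20 : n2 = 0 by apply: sqr_eq0_of_le0; nra.
    have n10 : n1 = 0 by apply: sqr_eq0_of_le0; nra.
    have := minv 1 0 0; rewrite /tangent -/n1 -/n2 n10 => /(_ ltac:(ring)).
    by rewrite /diag3 expr0n expr1n /=; lra.
  rewrite -(opprK s^-1) -invrN subr_ge0 lef_pV2 ?posrE ?oppr_gt0//; lra.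
Qed.

Lemma sheet2_elim A : sheet2 a b c A -> exists P s,
  [/\ onE a b c P, A = normal_pt P s, - be <= s, s <= - ga & 
   null_direction P s /\
   (forall v1 v2 v3,
     tangent P v1 v2 v3 ->
     shifted s v1 v2 v3 <= 0)].
Proof.
case=> P [k [PE [[kv kmax] ->]]].
have [||s [s0 sk AE vE maxv]] := @principal_elim (- 1) P k _ PE kv; first by rewrite sqrrN expr1n.
  by move=> v uv; rewrite !mulN1r lerN2; exact: kmax.
have {}maxv v1 v2 v3 : tangent P v1 v2 v3 ->
     shifted s v1 v2 v3 <= 0 by move=> /maxv; rewrite mulN1r oppr_ge0.
have sn : s != 0 by rewrite lt_eqF.
have ? := Va_gt0; have ? := ltVab; have ? := ltVbg.
exists P, s; split=> //.
- have : be^-1 + s^-1 <= 0.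
    rewrite leNgt; apply/negP => d2.
    set n3 := pz (Nvec a b c P); set n2 := py (Nvec a b c P).
    have := maxv 0 n3 (- n2); rewrite /tangent -/n3 -/n2 => /(_ ltac:(ring)).
    rewrite /diag3 expr0n /= mulr0 add0r sqrrN => h.
    have h1 := sqr_ge0 n3; have h2 := sqr_ge0 n2.
    have n20 : n2 = 0 by apply: sqr_eq0_of_le0; nra.
    have n30 : n3 = 0 by apply: sqr_eq0_of_le0; nra.
    have := maxv 0 0 1; rewrite /tangent -/n3 -/n2 n30 => /(_ ltac:(ring)).
    by rewrite /diag3 expr0n expr1n /=; lra.
  rewrite -(opprK s^-1) -invrN subr_le0 lef_pV2 ?posrE ?oppr_gt0//; lra.
- have [v1 [v2 [v3 [vp _]]]] := vE; rewrite /diag3 => v0.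
  have : 0 <= ga^-1 + s^-1.
    rewrite leNgt; apply/negP => d1.
    have : 0 < - (ga^-1 + s^-1) * (v1 ^+ 2 + v2 ^+ 2 + v3 ^+ 2) by rewrite mulr_gt0// oppr_gt0.
    have : 0 <= (ga^-1 - al^-1) * v1 ^+ 2 by rewrite mulr_ge0 ?sqr_ge0//; lra.
    have : 0 <= (ga^-1 - be^-1) * v2 ^+ 2 by rewrite mulr_ge0 ?sqr_ge0//; lra.
    by lra.
  rewrite -(opprK s^-1) -invrN subr_ge0 lef_pV2 ?posrE ?oppr_gt0//; lra.
Qed.

(** * Feet of normals and values of [footval] *)

Lemma foot_term (al0 x s : R) : 0 < al0 ->
  al0 * (x + s * (x / al0)) ^+ 2 / (al0 + s) ^+ 2 =
  (if al0 + s == 0 then 0 else x ^+ 2 / al0).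
Proof.
move=> al0p; case: eqP => [->|/eqP sn]; first by rewrite expr0n /= invr0 mulr0.
by field; rewrite sn gt_eqF.
Qed.

Lemma foot_adm (al0 x s : R) : 0 < al0 ->
  al0 * (x + s * (x / al0)) ^+ 2 != 0 -> al0 + s != 0.
Proof.
move=> al0p; apply: contraNneq => sE; have -> : s = - al0 by lra.
by apply/eqP; field; rewrite gt_eqF.
Qed.

Lemma footadm_normal_pt P s : footadm (normal_pt P s) s.
Proof.
by case: P => [[x y] z]; split; rewrite /normal_pt /px /py /pz /=; exact: foot_adm.
Qed.

(** Each term of [footval] is the matching term of the equation of the ellipsoid, except at a pole,
    where [0 / 0 = 0] replaces it; hence a mere inequality. *)
Lemma footval_normal_pt_le1 P s : onE a b c P -> footval (normal_pt P s) s <= 1.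
Proof.
case: P => [[x y] z]; rewrite /onE /footval /invsq /normal_pt /px /py /pz /= => E.
rewrite !foot_term// -E.
have le0 (d : bool) (u v : R) : 0 < v -> (if d then 0 else u ^+ 2 / v) <= u ^+ 2 / v.
  by move=> v0; case: d => //; rewrite divr_ge0 ?sqr_ge0// ltW.
by rewrite !lerD// le0.
Qed.

(** Away from the poles, the sum in the conclusion of [diag3_lagrange] is the derivative of
    [footval] up to a nonzero factor. *)
Lemma normal_pt_generic P s : onE a b c P -> s < 0 ->
  al + s != 0 -> be + s != 0 -> ga + s != 0 ->
  footval (normal_pt P s) s = 1 /\
  px (Nvec a b c P) ^+ 2 / (al^-1 + s^-1) + py (Nvec a b c P) ^+ 2 / (be^-1 + s^-1) +
  pz (Nvec a b c P) ^+ 2 / (ga^-1 + s^-1) =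
  s * invcube al be ga (al * px (normal_pt P s) ^+ 2) (be * py (normal_pt P s) ^+ 2)
       (ga * pz (normal_pt P s) ^+ 2) s.
Proof.
case: P => [[x y] z]; rewrite /onE /footval /invsq /invcube /normal_pt /Nvec /px /py /pz /=.
move=> E s0 als bes gas; split.
  by rewrite !foot_term// (negPf als) (negPf bes) (negPf gas).
have T (v u : R) : 0 < v -> v + s != 0 -> 
    (u / v) ^+ 2 / (v^-1 + s^-1) = s * (v * (u + s * (u / v)) ^+ 2 / (v + s) ^+ 3).
  move=> v0 vs.
  have -> : v^-1 + s^-1 = (v + s) / (v * s) by field; rewrite (gt_eqF v0) (lt_eqF s0).
  by field; rewrite vs (gt_eqF v0) (lt_eqF s0).
by rewrite !T// !mulrDr.
Qed.

Definition foot A s : R * R * R :=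
  (al * px A / (al + s), be * py A / (be + s), ga * pz A / (ga + s)).

Lemma foot_onE A s : footval A s = 1 -> onE a b c (foot A s).
Proof.
case: A => [[x y] z]; rewrite /footval /onE /invsq /foot /px /py /pz /= => <-.
have T (v u : R) : 0 < v -> (v * u / (v + s)) ^+ 2 / v = v * u ^+ 2 / (v + s) ^+ 2.
  by move=> v0; rewrite expr_div_n exprMn mulrAC; congr (_ / _); field; rewrite gt_eqF.
by rewrite !T.
Qed.

Lemma normal_pt_foot A s : footadm A s -> normal_pt (foot A s) s = A.
Proof.
case: A => [[x y] z] [/=]; rewrite /normal_pt /foot /Nvec /px /py /pz /= => xs ys zs.
have T (v u : R) : 0 < v -> (v * u ^+ 2 != 0 -> v + s != 0) ->
    v * u / (v + s) + s * (v * u / (v + s) / v) = u.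
  move=> v0; have [->|un] := eqVneq u 0; first by rewrite !(mulr0, mul0r) addr0.
  rewrite mulf_neq0 ?expf_neq0 ?(gt_eqF v0)// => /(_ isT) vs.
  by field; rewrite vs (gt_eqF v0).
by rewrite !T.
Qed.

Lemma sumsq_gt0 A s : footval A s = 1 -> 0 < al * px A ^+ 2 + be * py A ^+ 2 + ga * pz A ^+ 2.
Proof.
move=> H1; have x0 := cx_ge0 A; have y0 := cy_ge0 A; have z0 := cz_ge0 A.
rewrite lt_neqAle !addr_ge0// andbT; apply/negP => /eqP/esym S0.
have xE : al * px A ^+ 2 = 0 by lra.
have yE : be * py A ^+ 2 = 0 by lra.
have zE : ga * pz A ^+ 2 = 0 by lra.
by move: H1; rewrite /footval xE yE zE /invsq !mul0r !addr0 => /eqP; rewrite eq_sym oner_eq0.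
Qed.

(** * Points of the sheets as points where the minimum of [footval] is 1 *)

Definition stationary1 A s0 :=
  stationary al be ga (al * px A ^+ 2) (be * py A ^+ 2) (ga * pz A ^+ 2) s0.

Definition stationary2 A s0 :=
  stationary (- ga) (- be) (- al) (ga * pz A ^+ 2) (be * py A ^+ 2) (al * px A ^+ 2) (- s0).

(** With weights [(v * - s)^-1] and factor [- s], the normal at [foot A s] meets the hypotheses of
    [stationary_diag3], and [weight_inv] turns the resulting diagonal into the shifted form. *)
Let weight_sqr (v u s : R) : 0 < v -> s < 0 ->
  (v * u / (v + s) / v) ^+ 2 = - s * (v * - s)^-1 * (v * u ^+ 2 / (v + s) ^+ 2).
Proof.
move=> v0 s0; rewrite -exprVn; move: (v + s)^-1 => k.
by field; rewrite (gt_eqF v0) (lt_eqF s0).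
Qed.

Let weight_inv (v s : R) : 0 < v -> s < 0 ->
  - ((v * - s)^-1 * (v + s)) = v^-1 + s^-1.
Proof. by move=> v0 s0; field; rewrite (gt_eqF v0) (lt_eqF s0). Qed.

Let weight_gt0 (v s : R) : 0 < v -> s < 0 -> 0 < (v * - s)^-1.
Proof. by move=> v0 s0; rewrite invr_gt0 mulr_gt0// oppr_gt0. Qed.

Lemma sheet1_stationary A s0 : stationary1 A s0 -> footval A s0 = 1 -> sheet1 a b c A.
Proof.
move=> st H1; have [ps0 s0q ad0 _ _] := st; have nz := sumsq_gt0 H1.
have ? := be_gt0; have s0n : s0 < 0 by lra.
have x0 := cx_ge0 A; have y0 := cy_ge0 A; have z0 := cz_ge0 A.
have ka0 : 0 < - s0 by rewrite oppr_gt0.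
have [] := stationary_diag3 ltba2 ltgb x0 y0 z0 nz ka0
  (weight_gt0 al_gt0 s0n) (weight_gt0 be_gt0 s0n) (weight_gt0 ga_gt0 s0n)
  (weight_sqr (px A) al_gt0 s0n) (weight_sqr (py A) be_gt0 s0n)
  (weight_sqr (pz A) ga_gt0 s0n) st.
rewrite !weight_inv// => nd minv.
by rewrite -(normal_pt_foot ad0); apply: sheet1_intro => //; exact: foot_onE.
Qed.

(** The reflection changes the sign of the diagonal, so the shifted form is nonpositive on the
    tangent plane and the curvature is the larger one. *)
Lemma sheet2_stationary A s0 : stationary2 A s0 -> footval A s0 = 1 -> sheet2 a b c A.
Proof.
move=> st H1; have [ps0 s0q /admissible_opp ad0 _ _] := st; have nz := sumsq_gt0 H1.
have ? := ga_gt0; have s0n : s0 < 0 by lra.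
have x0 := cx_ge0 A; have y0 := cy_ge0 A; have z0 := cz_ge0 A.
have ka0 : 0 < - s0 by rewrite oppr_gt0.
have weight_sqrN (v u : R) : 0 < v -> (v * u / (v + s0) / v) ^+ 2 =
    - s0 * (v * - s0)^-1 * (v * u ^+ 2 / (- v - s0) ^+ 2).
  by move=> v0; rewrite weight_sqr// -opprD sqrrN.
have weight_invN (v : R) : 0 < v -> - ((v * - s0)^-1 * (- v - s0)) = - (v^-1 + s0^-1).
  by move=> v0; rewrite -weight_inv// -opprD mulrN !opprK.
have gb' : - be < - ga by rewrite ltrN2.
have ab' : - al < - be by rewrite ltrN2.
have nz' : 0 < ga * pz A ^+ 2 + be * py A ^+ 2 + al * px A ^+ 2 by lra.
have [] := stationary_diag3 gb' ab' z0 y0 x0 nz' ka0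
  (weight_gt0 ga_gt0 s0n) (weight_gt0 be_gt0 s0n) (weight_gt0 al_gt0 s0n)
  (weight_sqrN _ (pz A) ga_gt0) (weight_sqrN _ (py A) be_gt0)
  (weight_sqrN _ (px A) al_gt0) st.
rewrite !weight_invN// => -[v3 [v2 [v1 [vp vN v0]]]] minv.
rewrite -(normal_pt_foot ad0); apply: sheet2_intro => //; first exact: foot_onE.
  exists v1, v2, v3; split; first lra.
    by rewrite /tangent -[RHS]vN /foot /Nvec /px /py /pz /=; ring.
  by apply: oppr_inj; rewrite oppr0 -[RHS]v0 /diag3; ring.
move=> u1 u2 u3; rewrite /tangent => uN; rewrite -oppr_ge0.
have : - shifted s0 u1 u2 u3 =
    diag3 (- (ga^-1 + s0^-1)) (- (be^-1 + s0^-1)) (- (al^-1 + s0^-1)) u3 u2 u1.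
  by rewrite /diag3; ring.
move=> ->; apply: minv; rewrite -[RHS]uN /foot /Nvec /px /py /pz /=; ring.
Qed.

Lemma sheet1_footval A : sheet1 a b c A ->
  exists s, [/\ - al <= s, s <= - be, footadm A s & footval A s <= 1].
Proof.
move=> /sheet1_elim[P [s [PE -> als sbe _]]]; exists s; split=> //.
  exact: footadm_normal_pt.
exact: footval_normal_pt_le1.
Qed.

Lemma sheet2_footval A : sheet2 a b c A ->
  exists s, [/\ - be <= s, s <= - ga, footadm A s & footval A s <= 1].
Proof.
move=> /sheet2_elim[P [s [PE -> als sbe _]]]; exists s; split=> //.
  exact: footadm_normal_pt.
exact: footval_normal_pt_le1.
Qed.

Let normal_pt_coord_neq0 (v x s : R) : 0 < v -> x + s * (x / v) != 0 -> v + s != 0 /\ x != 0.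
Proof.
move=> v0 xn; split; apply: contraNneq xn => h; last by rewrite h mul0r mulr0 addr0.
by have -> : s = - v by [lra]; apply/eqP; field; rewrite (gt_eqF v0).
Qed.

(** If [s] were a pole, a coordinate of [A] would vanish. Off the coordinate planes the Lagrange
    condition therefore applies and makes [s] a critical point of [footval A]. *)
Lemma generic_principal_point A P s sg : sg ^+ 2 = 1 ->
  px A != 0 -> py A != 0 -> pz A != 0 -> onE a b c P -> A = normal_pt P s -> s < 0 ->
  null_direction P s ->
  (forall v1 v2 v3, tangent P v1 v2 v3 -> 0 <= sg * shifted s v1 v2 v3) ->
  [/\ al + s != 0, be + s != 0, ga + s != 0, footval A s = 1 &
    invcube al be ga (al * px A ^+ 2) (be * py A ^+ 2) (ga * pz A ^+ 2) s = 0].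
Proof.
move=> sg2 xn yn zn PE AE sn [v1 [v2 [v3 [vp vN v0]]]] minv.
have sgn : sg != 0 by apply: contra_eq_neq sg2 => ->; rewrite expr0n eq_sym oner_eq0.
have [as0 x0] : al + s != 0 /\ px P != 0.
  by apply: normal_pt_coord_neq0 => //; move: xn; rewrite AE.
have [bs0 y0] : be + s != 0 /\ py P != 0.
  by apply: normal_pt_coord_neq0 => //; move: yn; rewrite AE.
have [gs0 z0] : ga + s != 0 /\ pz P != 0.
  by apply: normal_pt_coord_neq0 => //; move: zn; rewrite AE.
have [H1 cubeE] := normal_pt_generic PE sn as0 bs0 gs0.
rewrite -AE in H1 cubeE; split=> //.
have dn (v : R) : 0 < v -> v + s != 0 -> sg * (v^-1 + s^-1) != 0.
  move=> vp0 vs; rewrite mulf_neq0//; have -> : v^-1 + s^-1 = (v + s) / (v * s).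
    by field; rewrite (gt_eqF vp0) (lt_eqF sn).
  by rewrite mulf_neq0// invr_eq0 mulf_neq0 ?(gt_eqF vp0) ?(lt_eqF sn).
have N0 : px (Nvec a b c P) != 0.
  by rewrite /Nvec /px /= mulf_neq0// invr_eq0 (gt_eqF al_gt0).
have sgE (d1 d2 d3 u1 u2 u3 : R) :
    diag3 (sg * d1) (sg * d2) (sg * d3) u1 u2 u3 = sg * diag3 d1 d2 d3 u1 u2 u3.
  by rewrite /diag3; ring.
have := diag3_lagrange (dn _ al_gt0 as0) (dn _ be_gt0 bs0) (dn _ ga_gt0 gs0) N0 vp vN.
rewrite sgE v0 mulr0 => /(_ erefl)/(_ _)/wrap[].
  by move=> w1 w2 w3 /minv; rewrite sgE.
move=> L; have {}L : sg^-1 * (s *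
    invcube al be ga (al * px A ^+ 2) (be * py A ^+ 2) (ga * pz A ^+ 2) s) = 0.
  by rewrite -cubeE -[RHS]L !invfM; ring.
move/eqP: L; rewrite !mulf_eq0 invr_eq0 (negPf sgn) (lt_eqF sn) /= => /eqP; exact.
Qed.

Lemma sheet1_generic A s0 : px A != 0 -> py A != 0 -> pz A != 0 ->
  sheet1 a b c A -> stationary1 A s0 -> footval A s0 = 1.
Proof.
move=> xn yn zn /sheet1_elim[P [s [PE AE als sbe [nd minv]]]] st.
have ? := be_gt0; have sn : s < 0 by lra.
have [||as0 bs0 gs0 H1 cube0] := @generic_principal_point A P s 1 _ xn yn zn PE AE sn nd.
- by rewrite expr1n.
- by move=> v1 v2 v3 /minv; rewrite mul1r.
suff <- : s = s0 by [].
apply: (stationary_uniq ltba2 ltgb (coef_ge0 (px A) al_gt0) (coef_ge0 (py A) be_gt0)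
  (coef_ge0 (pz A) ga_gt0) (sumsq_gt0 H1) st _ _ cube0).
- by rewrite lt_neqAle als andbT; apply: contraNneq as0 => <-; rewrite subrr.
- by rewrite lt_neqAle sbe andbT; apply: contraNneq bs0 => ->; rewrite subrr.
Qed.

Lemma sheet2_generic A s0 : px A != 0 -> py A != 0 -> pz A != 0 ->
  sheet2 a b c A -> stationary2 A s0 -> footval A s0 = 1.
Proof.
move=> xn yn zn /sheet2_elim[P [s [PE AE als sbe [nd maxv]]]] st.
have ? := ga_gt0; have sn : s < 0 by lra.
have [||as0 bs0 gs0 H1 cube0] := @generic_principal_point A P s (- 1) _ xn yn zn PE AE sn nd.
- by rewrite sqrrN expr1n.
- by move=> v1 v2 v3 /maxv; rewrite mulN1r oppr_ge0.
suff /oppr_inj <- : - s = - s0 by [].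
have gb' : - be < - ga by rewrite ltrN2.
have ab' : - al < - be by rewrite ltrN2.
have nz' : 0 < ga * pz A ^+ 2 + be * py A ^+ 2 + al * px A ^+ 2.
  by have := sumsq_gt0 H1; lra.
apply: (stationary_uniq gb' ab' (coef_ge0 (pz A) ga_gt0) (coef_ge0 (py A) be_gt0)
  (coef_ge0 (px A) al_gt0) nz' st).
- rewrite opprK lt_neqAle; apply/andP; split; last lra.
  by apply: contraNneq gs0 => ->; rewrite addNr.
- rewrite opprK lt_neqAle; apply/andP; split; last lra.
  by apply: contraNneq bs0 => <-; rewrite addNr.
- by rewrite invcube_opp cube0 oppr0.
Qed.

(** * The two regions separated by a sheet *)

Definition inner lo hi A :=
  exists s, [/\ lo <= s, s <= hi, footadm A s & footval A s < 1].

(** The margin [e] is uniform in [s]; this makes the region open without reference to the position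
    of the minimum. *)
Definition outer lo hi A := exists2 e, 0 < e &
  forall s, lo <= s -> s <= hi -> footadm A s -> 1 + e <= footval A s.

Lemma inner_outer lo hi A : inner lo hi A -> outer lo hi A -> False.
Proof.
move=> [s [los shi ads Hs]] [e e0 /(_ s los shi ads)]; rewrite leNgt => /negP; apply.
by rewrite (lt_trans Hs)// ltrDl.
Qed.

Lemma near_sqr_ge (T : topologicalType) (f : T -> R) (th : R) : continuous f -> th < 1 ->
  forall x, \forall y \near x, th * f x ^+ 2 <= f y ^+ 2.
Proof.
move=> cf th1 x; have [fx0|fx0] := eqVneq (f x) 0.
  by apply: nearW => y; rewrite fx0 expr0n mulr0 sqr_ge0.
have h : th * f x ^+ 2 < f x ^+ 2 by rewrite gtr_pMl// exprn_even_gt0.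
have c2 : (fun y => f y ^+ 2) y @[y --> x] --> f x ^+ 2.
  by rewrite expr2; apply: cvgM; exact: cf.
by near=> y; apply: ltW; near: y; exact: cvgr_gt c2 _ h.
Unshelve. all: by end_near. Qed.

(* Multiplying the squared coordinates by at least [th] multiplies [footval] by at least
   [th] for all [s] at once, hence no compactness argument on [s] is needed. *)
Lemma open_outer lo hi : open (outer lo hi).
Proof.
rewrite openE => A [e e0 HA]; rewrite /interior /=.
pose th := (1 + e / 2) / (1 + e).
have th1 : th < 1 by rewrite ltr_pdivrMr; lra.
have th0 : 0 < th by rewrite divr_gt0//; lra.
have := near_sqr_ge (@px_continuous R) th1 A; have := near_sqr_ge (@py_continuous R) th1 A.
have := near_sqr_ge (@pz_continuous R) th1 A.
apply: filterS3 => B Bz By Bx; exists (e / 2); first lra.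
move=> s los shi [xs ys zs].
have cmp (v u w : R) : 0 < v -> th * u ^+ 2 <= w ^+ 2 ->
    (v * w ^+ 2 != 0 -> v + s != 0) -> (v * u ^+ 2 != 0 -> v + s != 0) /\
    th * (v * u ^+ 2 / (v + s) ^+ 2) <= v * w ^+ 2 / (v + s) ^+ 2.
  move=> v0 uw ws; split; last first.
    have -> : th * (v * u ^+ 2 / (v + s) ^+ 2) = th * u ^+ 2 * (v / (v + s) ^+ 2) by ring.
    have -> : v * w ^+ 2 / (v + s) ^+ 2 = w ^+ 2 * (v / (v + s) ^+ 2) by ring.
    by rewrite ler_wpM2r// divr_ge0 ?sqr_ge0// ltW.
  rewrite mulf_eq0 (gt_eqF v0) /= => un; apply: ws; rewrite mulf_neq0 ?(gt_eqF v0)//.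
  rewrite gt_eqF// (lt_le_trans _ uw)// mulr_gt0// lt_neqAle eq_sym un sqr_ge0//.
have [xa xle] := cmp _ _ _ al_gt0 Bx xs.
have [ya yle] := cmp _ _ _ be_gt0 By ys.
have [za zle] := cmp _ _ _ ga_gt0 Bz zs.
have HAs := HA s los shi (And3 xa ya za).
have thE : th * (1 + e) = 1 + e / 2 by rewrite divfK// gt_eqF//; lra.
rewrite -thE; apply: (@le_trans _ _ (th * footval A s)); first by rewrite ler_pM2l.
by rewrite /footval /invsq !mulrDr !lerD.
Qed.

(** At an end of the interval admissibility may depend on [A], so [s] is first moved to an interior
    [t], where no denominator vanishes and [footval] is continuous in the point. *)
Lemma open_inner lo hi : lo < hi ->
  (forall t, lo < t -> t < hi -> [/\ al + t != 0, be + t != 0 & ga + t != 0]) ->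
  open (inner lo hi).
Proof.
move=> lohi nopole; rewrite openE => A [s [los shi ads Hs]]; rewrite /interior /=.
have [t [lot thi Ht]] : exists t, [/\ lo < t, t < hi & footval A t < 1].
  have : \forall t \near s, footval A t < 1.
    have cH : footval A t @[t --> s] --> footval A s by exact: invsq_continuous ads.
    exact: cvgr_lt cH _ Hs.
  move=> /nbhs_ballP[e /= e0 he].
  pose m := (lo + hi) / 2; pose d := e / (2 * (e + `|m - s|)).
  have N0 := normr_ge0 (m - s).
  have D0 : 0 < 2 * (e + `|m - s|) by rewrite mulr_gt0// ltr_pwDl.
  have d0 : 0 < d by rewrite divr_gt0.
  have d1 : d < 1 by rewrite ltr_pdivrMr//; lra.
  have dm : d * `|m - s| < e.
    by rewrite mulrAC ltr_pdivrMr// ltr_pM2l//; lra.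
  exists (s + d * (m - s)); split.
  - have : 0 < d * (m - lo) by rewrite mulr_gt0// /m; lra.
    by have : 0 <= (1 - d) * (s - lo) by [rewrite mulr_ge0//; lra]; lra.
  - have : 0 < d * (hi - m) by rewrite mulr_gt0// /m; lra.
    by have : 0 <= (1 - d) * (hi - s) by [rewrite mulr_ge0//; lra]; lra.
  - apply: he; rewrite /ball /= opprD addNKr normrN normrM (gtr0_norm d0)//.
have cF : (fun B => footval B t) B @[B --> A] --> footval A t.
  have cT (v k : R) (f : R * R * R -> R) : continuous f ->
      (fun B => v * f B ^+ 2 / k) B @[B --> A] --> v * f A ^+ 2 / k.
    move=> cf; apply: cvgM; last exact: cvg_cst.
    by apply: cvgM; [exact: cvg_cst|rewrite expr2; apply: cvgM; exact: cf].
  apply: cvgD; last exact: cT (@pz_continuous R).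
  by apply: cvgD; [exact: cT (@px_continuous R)|exact: cT (@py_continuous R)].
have : \forall B \near A, footval B t < 1 by exact: cvgr_lt cF _ Ht.
apply: filterS => B HB; exists t.
have [t1 t2 t3] := nopole t lot thi.
by split=> //; exact: ltW.
Qed.

(** Each term is below 1, so a nonzero coordinate [u] satisfies
    [v * u ^+ 2 < (v + s) ^+ 2 <= al ^+ 2]; then [u ^+ 2 <= K] implies that [u] is at most [1 + K]
    in absolute value. *)
Lemma bounded_inner lo hi : - al <= lo -> hi <= 0 -> bounded3 (inner lo hi).
Proof.
move=> allo hi0; exists (1 + al ^+ 2 / ga) => A [s [los shi [xs ys zs] Hs]].
have ? := ga_gt0; have ? := ltgb; have ? := ltba2.
have bd (v u : R) : ga <= v -> v <= al -> (v * u ^+ 2 != 0 -> v + s != 0) ->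
    v * u ^+ 2 / (v + s) ^+ 2 < 1 -> `|u| <= 1 + al ^+ 2 / ga.
  move=> gv va us T1; have v0 : 0 < v by lra.
  have K0 : 0 <= al ^+ 2 / ga by rewrite divr_ge0 ?sqr_ge0 ?ltW.
  have [->|un] := eqVneq u 0; first by rewrite normr0; lra.
  have vs : v + s != 0 by apply: us; rewrite mulf_neq0 ?(gt_eqF v0) ?expf_neq0.
  have U : v * u ^+ 2 < (v + s) ^+ 2.
    by move: T1; rewrite ltr_pdivrMr ?mul1r// exprn_even_gt0.
  have V : (v + s) ^+ 2 <= al ^+ 2 by rewrite -subr_ge0 subr_sqr mulr_ge0//; lra.
  have u2 : u ^+ 2 <= al ^+ 2 / ga.
    rewrite ler_pdivlMr// mulrC; apply: le_trans (le_trans (ltW U) V).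
    by rewrite ler_wpM2r// sqr_ge0.
  rewrite -real_normK ?num_real// in u2.
  rewrite leNgt; apply/negP => ult.
  by have := normr_ge0 u; nra.
have x0 (v u : R) : 0 < v -> 0 <= v * u ^+ 2 / (v + s) ^+ 2.
  by move=> v0; rewrite divr_ge0 ?sqr_ge0// coef_ge0.
have Tx := x0 _ (px A) al_gt0; have Ty := x0 _ (py A) be_gt0; have Tz := x0 _ (pz A) ga_gt0.
rewrite /footval /footval /invsq in Hs.
split; [|split].
- by apply: (bd al) => //; lra.
- by apply: (bd be) => //; lra.
- by apply: (bd ga) => //; lra.
Qed.

Lemma footval_scale l A s : footval (scale3 l A) s = l ^+ 2 * footval A s.
Proof. by rewrite /footval /invsq /scale3 /px /py /pz /= !exprMn; ring. Qed.

Lemma outer_scale lo hi l A : 1 <= l -> outer lo hi A -> outer lo hi (scale3 l A).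
Proof.
move=> l1 [e e0 HA]; exists e => // s los shi [xs ys zs].
have l0 : l != 0 by rewrite gt_eqF//; lra.
have adE (v u : R) : (v * (l * u) ^+ 2 != 0 -> v + s != 0) -> v * u ^+ 2 != 0 -> v + s != 0.
  move=> h vu; apply: h; rewrite exprMn mulrCA mulf_neq0 ?expf_neq0//.
rewrite footval_scale; apply: (le_trans (HA s los shi _)).
  by split; exact: adE.
rewrite ler_peMl//; first by apply: invsq_ge0; exact: coef_ge0.
by rewrite exprn_ege1.
Qed.

Lemma outer0 lo hi : lo <= hi -> ~ outer lo hi (0, 0, 0).
Proof.
move=> lohi [e e0 /(_ lo (lexx _) lohi)].
rewrite /footadm /admissible /footval /invsq /px /py /pz /=.
rewrite expr0n /= !mulr0 !mul0r eqxx !addr0 => h.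
have : 1 + e <= 0 by apply: h; split.
by lra.
Qed.

Definition sqsum A := al * px A ^+ 2 + be * py A ^+ 2 + ga * pz A ^+ 2.

Lemma sqsum_eq0 A : sqsum A <= 0 -> A = (0, 0, 0).
Proof.
have X := cx_ge0 A; have Y := cy_ge0 A; have Z := cz_ge0 A; rewrite /sqsum => S0.
have key (v u : R) : 0 < v -> v * u ^+ 2 = 0 -> u = 0.
  by move=> v0 /eqP; rewrite mulf_eq0 (gt_eqF v0) sqrf_eq0 => /eqP.
have E1 : px A = 0 by apply: (key al) => //; lra.
have E2 : py A = 0 by apply: (key be) => //; lra.
have E3 : pz A = 0 by apply: (key ga) => //; lra.
by case: A E1 E2 E3 {S0 X Y Z} => [[x y] z]; rewrite /px /py /pz /= => -> -> ->.
Qed.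

Let sqsumC A : 0 < sqsum A -> 0 < ga * pz A ^+ 2 + be * py A ^+ 2 + al * px A ^+ 2.
Proof. by rewrite /sqsum; lra. Qed.

Lemma stationary1_min A s0 : 0 < sqsum A -> stationary1 A s0 ->
  forall s, - al <= s -> s <= - be -> footadm A s -> footval A s0 <= footval A s.
Proof.
by move=> nz st; exact: (stationary_min ltba2 ltgb (cx_ge0 A) (cy_ge0 A) (cz_ge0 A) nz st).
Qed.

Lemma stationary2_min A s0 : 0 < sqsum A -> stationary2 A s0 ->
  forall s, - be <= s -> s <= - ga -> footadm A s -> footval A s0 <= footval A s.
Proof.
move=> nz st s bes sga ads.
rewrite /footval -!(invsq_opp al be ga).
apply: (stationary_min ltNgb ltNba (cz_ge0 A) (cy_ge0 A) (cx_ge0 A) (sqsumC nz) st).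
- by rewrite opprK; lra.
- by rewrite opprK; lra.
- exact/admissible_opp.
Qed.

Lemma stationary1_exists A : 0 < sqsum A -> exists s0, stationary1 A s0.
Proof. exact: stationary_exists. Qed.

Lemma stationary2_exists A : 0 < sqsum A -> exists s0, stationary2 A s0.
Proof.
move=> nz.
have [u st] := stationary_exists ltNgb ltNba (cz_ge0 A) (cy_ge0 A) (cx_ge0 A) (sqsumC nz).
by exists (- u); rewrite /stationary2 opprK.
Qed.

Lemma stationary1_itv A s0 : stationary1 A s0 -> [/\ - al <= s0, s0 <= - be & footadm A s0].
Proof. by case. Qed.

Lemma stationary2_itv A s0 : stationary2 A s0 -> [/\ - be <= s0, s0 <= - ga & footadm A s0].
Proof. by case=> h1 h2 /admissible_opp h3 _ _; split=> //; lra. Qed.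

Lemma inner1E A s0 : 0 < sqsum A -> stationary1 A s0 ->
  inner (- al) (- be) A <-> footval A s0 < 1.
Proof.
move=> nz st; have [h1 h2 h3] := stationary1_itv st; split; last by exists s0.
by case=> s [als sbe ads]; apply: le_lt_trans; exact: stationary1_min.
Qed.

Lemma inner2E A s0 : 0 < sqsum A -> stationary2 A s0 ->
  inner (- be) (- ga) A <-> footval A s0 < 1.
Proof.
move=> nz st; have [h1 h2 h3] := stationary2_itv st; split; last by exists s0.
by case=> s [als sbe ads]; apply: le_lt_trans; exact: stationary2_min.
Qed.

Lemma inner_origin lo hi : lo <= hi -> inner lo hi (0, 0, 0).
Proof.
move=> lohi; exists lo; split=> //.
  by split; rewrite /px /py /pz /= expr0n /= mulr0 eqxx.
by rewrite /footval /invsq /px /py /pz /= expr0n /= !mulr0 !mul0r !addr0 ltr01.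
Qed.

Lemma cover1 A : [\/ inner (- al) (- be) A, sheet1 a b c A | outer (- al) (- be) A].
Proof.
(* The origin is set apart: [footval] vanishes identically there and is not strictly convex. *)
have [/sqsum_eq0->|nz] := lerP (sqsum A) 0.
  by apply: Or31; apply: inner_origin; rewrite lerN2 ltW.
have [s0 st] := stationary1_exists nz.
have [h|h|h] := ltgtP (footval A s0) 1.
- by apply: Or31; apply/(inner1E nz st).
- apply: Or33; exists (footval A s0 - 1); first by rewrite subr_gt0.
  by move=> s als sbe ads; rewrite addrC subrK; exact: stationary1_min.
- by apply: Or32; exact: sheet1_stationary st h.
Qed.

Lemma cover2 A : [\/ inner (- be) (- ga) A, sheet2 a b c A | outer (- be) (- ga) A].
Proof.
have [/sqsum_eq0->|nz] := lerP (sqsum A) 0.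
  by apply: Or31; apply: inner_origin; rewrite lerN2 ltW.
have [s0 st] := stationary2_exists nz.
have [h|h|h] := ltgtP (footval A s0) 1.
- by apply: Or31; apply/(inner2E nz st).
- apply: Or33; exists (footval A s0 - 1); first by rewrite subr_gt0.
  by move=> s als sbe ads; rewrite addrC subrK; exact: stationary2_min.
- by apply: Or32; exact: sheet2_stationary st h.
Qed.

Lemma outer_footval lo hi A s : outer lo hi A -> lo <= s -> s <= hi ->
  footadm A s -> footval A s <= 1 -> False.
Proof.
move=> [e e0 h] los shi ads; rewrite leNgt => /negP; apply.
by apply: lt_le_trans (h s los shi ads); rewrite ltrDl.
Qed.

Lemma outer1_sheet1 A : outer (- al) (- be) A -> ~ sheet1 a b c A.
Proof.
move=> oA /sheet1_footval[s [als sbe ads Hs]].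
exact: outer_footval oA als sbe ads Hs.
Qed.

Lemma outer2_sheet2 A : outer (- be) (- ga) A -> ~ sheet2 a b c A.
Proof.
move=> oA /sheet2_footval[s [als sbe ads Hs]].
exact: outer_footval oA als sbe ads Hs.
Qed.

Lemma open_inner1 : open (inner (- al) (- be)).
Proof.
apply: open_inner => // t alt tbe; import_hyps.
by split; [apply: lt0r_neq0|apply: ltr0_neq0|apply: ltr0_neq0]; lra.
Qed.

Lemma open_inner2 : open (inner (- be) (- ga)).
Proof.
apply: open_inner => // t alt tbe; import_hyps.
by split; [apply: lt0r_neq0|apply: lt0r_neq0|apply: ltr0_neq0]; lra.
Qed.

Lemma inside1E A : ~ sheet1 a b c A ->
  (inside (sheet1 a b c) A <-> inner (- al) (- be) A).
Proof.
apply: (@inside_region R (sheet1 a b c) (inner (- al) (- be)) (outer (- al) (- be))).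
- exact: open_inner1.
- exact: open_outer.
- exact: inner_outer.
- exact: cover1.
- exact: outer1_sheet1.
- by apply: bounded_inner => //; rewrite oppr_le0 ltW.
- by apply: outer0; rewrite ltW.
- exact: outer_scale.
Qed.

Lemma inside2E A : ~ sheet2 a b c A ->
  (inside (sheet2 a b c) A <-> inner (- be) (- ga) A).
Proof.
apply: (@inside_region R (sheet2 a b c) (inner (- be) (- ga)) (outer (- be) (- ga))).
- exact: open_inner2.
- exact: open_outer.
- exact: inner_outer.
- exact: cover2.
- exact: outer2_sheet2.
- by apply: bounded_inner => //; [rewrite ltW|rewrite oppr_le0 ltW].
- by apply: outer0; rewrite ltW.
- exact: outer_scale.
Qed.

(** * Intersections of the sheets with the ellipsoid *)

Lemma footval0 A : footval A 0 = px A ^+ 2 / al + py A ^+ 2 / be + pz A ^+ 2 / ga.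
Proof.
by rewrite /footval /invsq !addr0; field;
  rewrite (gt_eqF a_gt0) (gt_eqF b_gt0) (gt_eqF c_gt0).
Qed.

Lemma onE_footval0 A : onE a b c A -> footval A 0 = 1.
Proof. by rewrite footval0. Qed.

(** For [v >= ga] such an [s] satisfies [- v < v + s < v], so each nonzero term is larger than at
    [s = 0], where the sum is 1. *)
Lemma footval_onE_gt1 A s : onE a b c A -> - (2 * ga) < s -> s < 0 -> footadm A s ->
  1 < footval A s.
Proof.
import_hyps; move=> /onE_footval0 AE gs s0 [xs ys zs]; rewrite -AE.
have nz : 0 < sqsum A by exact: sumsq_gt0 AE.
have key (v u : R) : ga <= v -> (v * u ^+ 2 != 0 -> v + s != 0) ->
    v * u ^+ 2 / v ^+ 2 <= v * u ^+ 2 / (v + s) ^+ 2 ?= iff (v * u ^+ 2 == 0).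
  move=> gv; have [->|un /(_ isT) vs] := eqVneq (v * u ^+ 2) 0.
    by rewrite !mul0r; split; rewrite ?eqxx.
  have v0 : 0 < v by lra.
  suff h : v * u ^+ 2 / v ^+ 2 < v * u ^+ 2 / (v + s) ^+ 2 by split; [exact: ltW|exact: lt_eqF].
  rewrite ltr_pM2l; last by rewrite lt_neqAle eq_sym un coef_ge0.
  rewrite ltf_pV2 ?posrE ?exprn_even_gt0 //= ?(gt_eqF v0)//.
  by rewrite -subr_gt0 subr_sqr mulr_gt0//; lra.
have [Lx Ex] := key al (px A) ltac:(lra) xs.
have [Ly Ey] := key be (py A) ltac:(lra) ys.
have [Lz Ez] := key ga (pz A) ltac:(lra) zs.
rewrite /footval /invsq !addr0 lt_neqAle !lerD// andbT; apply/negP => /eqP eqs.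
have eqx : al * px A ^+ 2 / al ^+ 2 == al * px A ^+ 2 / (al + s) ^+ 2 by apply/eqP; lra.
have eqy : be * py A ^+ 2 / be ^+ 2 == be * py A ^+ 2 / (be + s) ^+ 2 by apply/eqP; lra.
have eqz : ga * pz A ^+ 2 / ga ^+ 2 == ga * pz A ^+ 2 / (ga + s) ^+ 2 by apply/eqP; lra.
move: eqx eqy eqz nz; rewrite /sqsum Ex Ey Ez => /eqP-> /eqP-> /eqP->.
by rewrite !addr0 ltxx.
Qed.

Lemma sheet1_misses_E : al < 2 * ga -> ~ meets_E a b c (sheet1 a b c).
Proof.
import_hyps; move=> ag [A [/sheet1_footval[s [als sbe ads Hs]] AE]].
have s2 : - (2 * ga) < s by clear Hs; lra.
have s0 : s < 0 by clear Hs; lra.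
by have := footval_onE_gt1 AE s2 s0 ads; rewrite ltNge Hs.
Qed.

Lemma sheet2_misses_E : be < 2 * ga -> ~ meets_E a b c (sheet2 a b c).
Proof.
import_hyps; move=> ag [A [/sheet2_footval[s [als sbe ads Hs]] AE]].
have s2 : - (2 * ga) < s by clear Hs; lra.
have s0 : s < 0 by clear Hs; lra.
by have := footval_onE_gt1 AE s2 s0 ads; rewrite ltNge Hs.
Qed.

(** The section of the ellipsoid by the plane of its longest and shortest axes. *)
Definition arc (t : R) : R * R * R := (a * sin t, 0, c * cos t).

Lemma arc_connected : connected (range arc).
Proof.
apply: connected_continuous_connected.
  by apply/connected_intervalP => x y _ _ z _.
apply: continuous_subspaceT; apply: triple_continuous.
- by move=> t; apply: cvgM; [exact: cvg_cst|exact: continuous_sin].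
- by move=> t; exact: cvg_cst.
- by move=> t; apply: cvgM; [exact: cvg_cst|exact: continuous_cos].
Qed.

Lemma arc_onE t : onE a b c (arc t).
Proof.
rewrite /onE /arc /px /py /pz /= -(cos2Dsin2 t); field.
by rewrite (gt_eqF a_gt0) (gt_eqF b_gt0) (gt_eqF c_gt0).
Qed.

Lemma sheet_meets_E (S I O : set (R * R * R)) : open I -> open O ->
  (forall x, I x -> O x -> False) -> (forall x, [\/ I x, S x | O x]) ->
  ~ O (0, 0, c) -> ~ I (a, 0, 0) -> meets_E a b c S.
Proof.
move=> oI oO IO cover nO nI.
have arc0 : arc 0 = (0, 0, c) by rewrite /arc sin0 cos0 mulr0 mulr1.
have arc1 : arc (pi / 2) = (a, 0, 0) by rewrite /arc sin_pihalf cos_pihalf mulr0 mulr1.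
apply: contrapT => nS.
have arcS : range arc `<=` ~` S.
  by move=> x [t _ <-] St; apply: nS; exists (arc t); split=> //; exact: arc_onE.
apply: nI; apply: (connected_in_region oI oO IO cover arc_connected arcS (A := arc 0)).
- by exists 0.
- by case: (cover (arc 0)) => // [/arcS|]; rewrite arc0//; case; exists 0.
- by exists (pi / 2).
Qed.

(** The only term is [al ^+ 2 / (al + s) ^+ 2], which exceeds 1 for [- al < s < 0]. *)
Lemma inner_vertex lo hi : - al <= lo -> hi < 0 -> ~ inner lo hi (a, 0, 0).
Proof.
import_hyps; have ? := al_gt0; move=> allo hi0 [s [los shi [xs _ _]]].
rewrite /footval /invsq /px /py /pz /= expr0n /= !mulr0 !mul0r !addr0.
rewrite /px /= in xs.
have als : al + s != 0 by apply: xs; rewrite mulf_neq0 ?(gt_eqF al_gt0).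
rewrite ltr_pdivrMr ?exprn_even_gt0// mul1r -expr2 -subr_gt0 subr_sqr => h.
have : 0 < (- s) * (al + s + al) by rewrite mulr_gt0//; lra.
by lra.
Qed.

(** The only term is [ga ^+ 2 / (ga + s) ^+ 2], which is at most 1 at [s = lo]. *)
Lemma outer_vertex lo hi : lo <= hi -> lo <= - (2 * ga) -> ~ outer lo hi (0, 0, c).
Proof.
import_hyps; move=> lohi lo2 oA; apply: (outer_footval oA (lexx _) lohi).
  split; rewrite /px /py /pz /=; rewrite ?expr0n /= ?mulr0 ?eqxx// => _.
  by apply: ltr0_neq0; lra.
rewrite /footval /invsq /px /py /pz /= expr0n /= !mulr0 !mul0r !add0r.
rewrite ler_pdivrMr ?exprn_even_gt0//=; last by lra.
by rewrite mul1r -expr2 -subr_ge0 subr_sqr mulr_le0//; lra.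
Qed.

Lemma sheet1_meets_E : 2 * ga <= al -> meets_E a b c (sheet1 a b c).
Proof.
import_hyps; move=> ga2.
apply: (@sheet_meets_E (sheet1 a b c) (inner (- al) (- be)) (outer (- al) (- be))).
- exact: open_inner1.
- exact: open_outer.
- exact: inner_outer.
- exact: cover1.
- by apply: outer_vertex; lra.
- by apply: inner_vertex; lra.
Qed.

Lemma sheet2_meets_E : 2 * ga <= be -> meets_E a b c (sheet2 a b c).
Proof.
import_hyps; move=> ga2.
apply: (@sheet_meets_E (sheet2 a b c) (inner (- be) (- ga)) (outer (- be) (- ga))).
- exact: open_inner2.
- exact: open_outer.
- exact: inner_outer.
- exact: cover2.
- by apply: outer_vertex; lra.
- by apply: inner_vertex; lra.
Qed.

(** * The correspondence between codes and feet of normals *)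

Local Notation foot_code A :=
  (is_code al be ga (al * px A ^+ 2) (be * py A ^+ 2) (ga * pz A ^+ 2)).

(** At a pole the equation of the normal leaves this coordinate undetermined, and [w0] supplies
    it. *)
Definition foot_coord (v u w0 s : R) : R := if v + s == 0 then w0 else v * u / (v + s).

(** The factors [a], [b], [c] make the free coordinate contribute [cd.2 ^+ 2] to the equation of the
    ellipsoid, whatever the axis. *)
Definition foot_of_code A (cd : R * R) : R * R * R :=
  (foot_coord al (px A) (a * cd.2) cd.1, foot_coord be (py A) (b * cd.2) cd.1,
   foot_coord ga (pz A) (c * cd.2) cd.1).

Lemma foot_coord_normal (v u w0 s : R) : 0 < v -> (v * u ^+ 2 != 0 -> v + s != 0) ->
  foot_coord v u w0 s + s * (foot_coord v u w0 s / v) = u.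
Proof.
move=> v0 us; rewrite /foot_coord; case: eqVneq => [sE|vs]; last first.
  by field; rewrite vs (gt_eqF v0).
have -> : u = 0.
  apply/eqP; apply: contraT => un.
  by have := us ltac:(by rewrite mulf_neq0 ?(gt_eqF v0) ?expf_neq0); rewrite sE eqxx.
have -> : s = - v by lra.
by field; rewrite (gt_eqF v0).
Qed.

Lemma code_normal_pt A cd : foot_code A cd -> normal_pt (foot_of_code A cd) cd.1 = A.
Proof.
case: cd => s w [[xs ys zs] _ _]; case: A xs ys zs => [[x y] z].
rewrite /normal_pt /foot_of_code /Nvec /px /py /pz /= => xs ys zs.
by rewrite !foot_coord_normal.
Qed.

Lemma foot_coord_sqr (v u d w s : R) : 0 < v -> d ^+ 2 = v ->
  foot_coord v u (d * w) s ^+ 2 / v =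
  v * u ^+ 2 / (v + s) ^+ 2 + (if v + s == 0 then w ^+ 2 else 0).
Proof.
move=> v0 dv; rewrite /foot_coord; case: eqVneq => [->|vs].
  by rewrite expr0n invr0 mulr0 add0r exprMn dv mulrC mulKf// gt_eqF.
by rewrite addr0; field; rewrite vs (gt_eqF v0).
Qed.

Let pole_eq (v s : R) : (v + s == 0) = (s == - v).
Proof. by rewrite addrC addr_eq0. Qed.

Let sum6 (x y z i j k : R) : (x + i) + (y + j) + (z + k) = x + y + z + (i + j + k).
Proof. by ring. Qed.

Let one_pole (s k : R) : (s != - al -> s != - be -> s != - ga -> k = 0) ->
  (if al + s == 0 then k else 0) + (if be + s == 0 then k else 0) +
  (if ga + s == 0 then k else 0) = k.
Proof.
import_hyps; rewrite !pole_eq.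
case: eqVneq => [->|sa].
  by rewrite !lt_eqF ?ltrN2 ?addr0//; exact: lt_trans ltba2.
case: eqVneq => [->|sb]; first by rewrite lt_eqF ?ltrN2// add0r addr0.
by case: eqVneq => [_ _|_ ->//]; rewrite !add0r.
Qed.

Lemma code_onE A cd : foot_code A cd -> onE a b c (foot_of_code A cd).
Proof.
case: cd => s w [_ /= E w0].
rewrite /onE -[RHS]E /invsq -[px (foot_of_code _ _)]/(foot_coord al (px A) (a * w) s).
rewrite -[py (foot_of_code _ _)]/(foot_coord be (py A) (b * w) s).
rewrite -[pz (foot_of_code _ _)]/(foot_coord ga (pz A) (c * w) s).
rewrite -(@one_pole s (w ^+ 2)); last by move=> ? ? ?; rewrite w0// expr0n.
by rewrite !foot_coord_sqr// sum6.
Qed.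

Lemma normal_pt_inj P s t : onE a b c P -> normal_pt P s = normal_pt P t -> s = t.
Proof.
move=> PE [/addrI ex /addrI ey /addrI ez].
have := normN_gt0 PE; rewrite sqrtr_gt0 => N0.
apply/eqP; rewrite -subr_eq0; apply: contraT => st.
have key (n : R) : s * n = t * n -> n = 0.
  by move=> /eqP; rewrite -subr_eq0 -mulrBl mulf_eq0 (negPf st) => /eqP.
have ez' : pz (Nvec a b c P) = 0 := key _ ez.
by move: N0; rewrite /dot (key _ ex) (key _ ey) ez' mul0r !addr0 ltxx.
Qed.

(** The foot determines the parameter, namely the position of [A] on the normal there; at a pole the
    matching coordinate gives back the second component, which is 0 elsewhere. *)
Lemma foot_of_code_inj A cd1 cd2 : foot_code A cd1 -> foot_code A cd2 ->
  foot_of_code A cd1 = foot_of_code A cd2 -> cd1 = cd2.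
Proof.
move=> h1 h2 E.
have sE : cd1.1 = cd2.1.
  by apply: (normal_pt_inj (code_onE h1)); rewrite {2}E !code_normal_pt.
case: cd1 cd2 sE h1 h2 E => [s w1] [t w2] /= <- {t} [_ _ w10] [_ _ w20] [].
rewrite /= in w10 w20; rewrite /foot_coord !pole_eq.
have [sa /(mulfI (lt0r_neq0 a_gt0))->//|sa _] := eqVneq s (- al).
have [sb /(mulfI (lt0r_neq0 b_gt0))->//|sb _] := eqVneq s (- be).
have [sg /(mulfI (lt0r_neq0 c_gt0))->//|sg _] := eqVneq s (- ga).
by rewrite w10// w20.
Qed.

Lemma code_of_foot B s : onE a b c B -> exists w,
  foot_code (normal_pt B s) (s, w) /\ foot_of_code (normal_pt B s) (s, w) = B.
Proof.
import_hyps; move=> BE.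
pose w := if s == - al then px B / a else if s == - be then py B / b else
  if s == - ga then pz B / c else 0.
have w0 : s != - al -> s != - be -> s != - ga -> w = 0.
  by rewrite /w => /negPf-> /negPf-> /negPf->.
have wx : s = - al -> w = px B / a by rewrite /w => ->; rewrite eqxx.
have wy : s = - be -> w = py B / b.
  by rewrite /w => ->; rewrite gt_eqF ?ltrN2// eqxx.
have wz : s = - ga -> w = pz B / c.
  by rewrite /w => ->; rewrite (gt_eqF (lt_trans ltNba ltNgb)) (gt_eqF ltNgb) eqxx.
exists w; split.
  split=> //=.
    by have := footadm_normal_pt B s.
  have sq := @one_pole s (w ^+ 2); rewrite -[w ^+ 2]sq; last by move=> ? ? ?; rewrite w0// expr0n.
  rewrite -[RHS]BE /invsq.
  have key (v u d : R) : 0 < v -> d ^+ 2 = v -> (s = - v -> w = u / d) ->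
     v * (u + s * (u / v)) ^+ 2 / (v + s) ^+ 2 + (if v + s == 0 then w ^+ 2 else 0) = u ^+ 2 / v.
    move=> v0 dv wE; rewrite foot_term// pole_eq; case: eqVneq => [/wE->|_]; last by rewrite addr0.
    by rewrite add0r expr_div_n dv.
  by rewrite -(key al (px B) a)// -(key be (py B) b)// -(key ga (pz B) c)// sum6.
have key (v u d : R) : 0 < v -> d != 0 -> (s = - v -> w = u / d) ->
    foot_coord v (u + s * (u / v)) (d * w) s = u.
  move=> v0 dn wE; rewrite /foot_coord; case: eqVneq => [/eqP|vs].
    by rewrite pole_eq => /eqP/wE->; rewrite mulrCA divff ?mulr1.
  by field; rewrite vs (gt_eqF v0).
rewrite [RHS](_ : B = (px B, py B, pz B)); last by case: (B) => [[]].
by congr (_, _, _); apply: key; rewrite ?lt0r_neq0.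
Qed.

Lemma n_eq_code A n : has_card (foot_code A) n -> n_eq a b c A n.
Proof.
apply: (has_card_image (f := foot_of_code A)); first exact: foot_of_code_inj.
move=> B; split.
  case=> BE [s AE]; have [w [cw Bw]] := code_of_foot s BE.
  by exists (s, w); rewrite AE.
case=> cd cdA ->; split; first exact: code_onE.
by exists cd.1; rewrite -[LHS](code_normal_pt cdA).
Qed.

(** * The number of normals through a point of the ellipsoid *)

Section NormalCount.
Local Notation groupA A :=
  (group1 al be ga (al * px A ^+ 2) (be * py A ^+ 2) (ga * pz A ^+ 2)).
Local Notation groupB A :=
  (group2 al be ga (al * px A ^+ 2) (be * py A ^+ 2) (ga * pz A ^+ 2)).

Variable A : R * R * R.
Hypotheses (AE : onE a b c A) (nexc : ~ exceptional a b c A).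

Let A0 : footval A 0 = 1. Proof. exact: onE_footval0. Qed.
Let nz : 0 < al * px A ^+ 2 + be * py A ^+ 2 + ga * pz A ^+ 2.
Proof. exact: sumsq_gt0 A0. Qed.
Let nzC : 0 < ga * pz A ^+ 2 + be * py A ^+ 2 + al * px A ^+ 2.
Proof. by have := nz; lra. Qed.

Let ad_pole (v u : R) : (v * u ^+ 2 != 0 -> v + - v != 0) -> v * u ^+ 2 = 0.
Proof. by rewrite subrr eqxx => h; apply/eqP; apply: contraT => /h. Qed.

(** The value 1 at this removable pole would be the minimum, placing [A] on a sheet and in a
    coordinate plane, which is exceptional. *)
Lemma pole_al_neq1 : footadm A (- al) -> footval A (- al) != 1.
Proof.
case=> /ad_pole xE _ _; apply/eqP => H1; apply: nexc; right; split.
  left; apply: (sheet1_stationary _ H1).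
  exact: stationary_left.
by left; exact: coef_eq0 xE.
Qed.

(** This pole bounds both intervals; the sign of [invcube] there decides for which of them it is the
    minimum, hence on which sheet [A] would lie. *)
Lemma pole_be_neq1 : footadm A (- be) -> footval A (- be) != 1.
Proof.
case=> _ /ad_pole yE _; apply/eqP => H1; apply: nexc; right; split; last first.
  by right; left; exact: coef_eq0 yE.
have [d0|d0] := lerP 0 (invcube al be ga (al * px A ^+ 2) (be * py A ^+ 2) (ga * pz A ^+ 2) (- be)).
  left; apply: (sheet1_stationary _ H1).
  exact: stationary_right.
right; apply: (sheet2_stationary _ H1).
apply: stationary_right => //.
by rewrite invcube_opp oppr_ge0 ltW.
Qed.

Lemma pole_ga_neq1 : footadm A (- ga) -> footval A (- ga) != 1.
Proof.
move=> adg; rewrite -A0 gt_eqF//.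
by apply: invsq_decr_high => //; rewrite ?oppr_lt0.
Qed.

Lemma n_eq_groups n1 n2 : has_card (groupA A) n1 -> has_card (groupB A) n2 ->
  n_eq a b c A (n1 + n2 + 2)%N.
Proof.
move=> G1 G2; apply: n_eq_code => //; apply: code_count => //.
- exact: pole_al_neq1.
- exact: pole_be_neq1.
Qed.

Let one2 : (1 : R) ^+ 2 = 1. Proof. exact: expr1n. Qed.
Let mone2 : (- 1 : R) ^+ 2 = 1. Proof. by rewrite sqrrN expr1n. Qed.

Lemma group1_inner : inner (- al) (- be) A -> has_card (groupA A) 2.
Proof.
have [s0 st] := stationary1_exists nz.
move=> /(inner1E nz st) H1.
apply: (middle_group_lt1 ltba2 ltgb (cx_ge0 A) (cy_ge0 A) (cz_ge0 A) nz one2 one2 st) => //.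
- exact: pole_al_neq1.
- exact: pole_be_neq1.
Qed.

Lemma group1_outer : ~ sheet1 a b c A -> ~ inner (- al) (- be) A -> has_card (groupA A) 0.
Proof.
have [s0 st] := stationary1_exists nz.
rewrite (inner1E nz st) => nS nI.
apply: (middle_group_gt1 ltba2 ltgb (cx_ge0 A) (cy_ge0 A) (cz_ge0 A) nz _ _ st).
have [//|//|H1] := ltgtP (footval A s0) 1.
by case: nS; exact: (sheet1_stationary st H1).
Qed.

Lemma group2_inner : inner (- be) (- ga) A -> has_card (groupB A) 2.
Proof.
have [s0 st] := stationary2_exists nz.
move=> /(inner2E nz st) H1; apply: group2_count.
apply: (middle_group_lt1 ltNgb ltNba (cz_ge0 A) (cy_ge0 A) (cx_ge0 A) nzC one2 mone2 st) => //.
- by rewrite invsq_opp => /admissible_opp; exact: pole_ga_neq1.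
- by rewrite invsq_opp => /admissible_opp; exact: pole_be_neq1.
- by rewrite invsq_opp.
Qed.

Lemma group2_outer : ~ sheet2 a b c A -> ~ inner (- be) (- ga) A -> has_card (groupB A) 0.
Proof.
have [s0 st] := stationary2_exists nz.
rewrite (inner2E nz st) => nS nI; apply: group2_count.
apply: (middle_group_gt1 ltNgb ltNba (cz_ge0 A) (cy_ge0 A) (cx_ge0 A) nzC _ _ st).
rewrite invsq_opp; have [//|//|H1] := ltgtP (footval A s0) 1.
by case: nS; exact: (sheet2_stationary st H1).
Qed.

Let generic_coord : sheet1 a b c A \/ sheet2 a b c A ->
  [/\ px A != 0, py A != 0 & pz A != 0].
Proof.
by move=> S; split; apply/eqP => E; apply: nexc; right; split=> //; [left|right;left|right;right].
Qed.

Lemma group1_sheet : sheet1 a b c A -> has_card (groupA A) 1.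
Proof.
move=> S; have [xn yn zn] := generic_coord (or_introl S).
have [s0 st] := stationary1_exists nz.
apply: (middle_group_eq1 ltba2 ltgb (cx_ge0 A) (cy_ge0 A) (cz_ge0 A) nz _ _ st).
- by apply: mulf_neq0; [exact: lt0r_neq0|exact: expf_neq0].
- by apply: mulf_neq0; [exact: lt0r_neq0|exact: expf_neq0].
- exact: (sheet1_generic xn yn zn S st).
Qed.

Lemma group2_sheet : sheet2 a b c A -> has_card (groupB A) 1.
Proof.
move=> S; have [xn yn zn] := generic_coord (or_intror S).
have [s0 st] := stationary2_exists nz; apply: group2_count.
apply: (middle_group_eq1 ltNgb ltNba (cz_ge0 A) (cy_ge0 A) (cx_ge0 A) nzC _ _ st).
- by apply: mulf_neq0; [exact: lt0r_neq0|exact: expf_neq0].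
- by apply: mulf_neq0; [exact: lt0r_neq0|exact: expf_neq0].
- by rewrite invsq_opp; exact: (sheet2_generic xn yn zn S st).
Qed.

Lemma group1_inside : ~ sheet1 a b c A -> inside (sheet1 a b c) A -> has_card (groupA A) 2.
Proof. by move=> nS /(inside1E nS); exact: group1_inner. Qed.

Lemma group1_outside : ~ sheet1 a b c A -> ~ inside (sheet1 a b c) A -> has_card (groupA A) 0.
Proof. by move=> nS; rewrite (inside1E nS); exact: group1_outer. Qed.

Lemma group2_inside : ~ sheet2 a b c A -> inside (sheet2 a b c) A -> has_card (groupB A) 2.
Proof. by move=> nS /(inside2E nS); exact: group2_inner. Qed.

Lemma group2_outside : ~ sheet2 a b c A -> ~ inside (sheet2 a b c) A -> has_card (groupB A) 0.
Proof. by move=> nS; rewrite (inside2E nS); exact: group2_outer. Qed.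

(** Each sheet contributes 2, 1 or 0 feet according as [A] is inside, on or outside it, added to the
    two feet always present. *)
Lemma normal_count :
  (~ sheet1 a b c A /\ ~ sheet2 a b c A /\
   ~ inside (sheet1 a b c) A /\ ~ inside (sheet2 a b c) A -> n_eq a b c A 2) /\
  (~ sheet1 a b c A /\ ~ sheet2 a b c A /\
   ((inside (sheet1 a b c) A /\ ~ inside (sheet2 a b c) A) \/
    (~ inside (sheet1 a b c) A /\ inside (sheet2 a b c) A)) -> n_eq a b c A 4) /\
  (~ sheet1 a b c A /\ ~ sheet2 a b c A /\
   inside (sheet1 a b c) A /\ inside (sheet2 a b c) A -> n_eq a b c A 6) /\
  (sheet1 a b c A \/ sheet2 a b c A -> n_eq a b c A 3 \/ n_eq a b c A 5).
Proof.
split; [|split; [|split]].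
- move=> [nS1 [nS2 [nI1 nI2]]].
  exact: (n_eq_groups (group1_outside nS1 nI1) (group2_outside nS2 nI2)).
- move=> [nS1 [nS2 [[I1 nI2]|[nI1 I2]]]].
    exact: (n_eq_groups (group1_inside nS1 I1) (group2_outside nS2 nI2)).
  exact: (n_eq_groups (group1_outside nS1 nI1) (group2_inside nS2 I2)).
- move=> [nS1 [nS2 [I1 I2]]].
  exact: (n_eq_groups (group1_inside nS1 I1) (group2_inside nS2 I2)).
(* Since [A] is not exceptional it lies on one sheet only, and the other sheet contributes 0 or
   2. *)
- case=> S.
    have nS2 : ~ sheet2 a b c A by move=> S2; apply: nexc; left.
    have [I2|nI2] := pselect (inside (sheet2 a b c) A); [right|left].
      exact: (n_eq_groups (group1_sheet S) (group2_inside nS2 I2)).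
    exact: (n_eq_groups (group1_sheet S) (group2_outside nS2 nI2)).
  have nS1 : ~ sheet1 a b c A by move=> S1; apply: nexc; left.
  have [I1|nI1] := pselect (inside (sheet1 a b c) A); [right|left].
    exact: (n_eq_groups (group1_inside nS1 I1) (group2_sheet S)).
  exact: (n_eq_groups (group1_outside nS1 nI1) (group2_sheet S)).
Qed.

End NormalCount.

End Caustic.

Theorem theorem4 (R : realType) (a b c : R) :
  0 < c -> c < b -> b < a ->
  (a ^+ 2 < 2 * c ^+ 2 ->
     ~ meets_E a b c (sheet1 a b c) /\ ~ meets_E a b c (sheet2 a b c)) /\
  (b ^+ 2 < 2 * c ^+ 2 -> 2 * c ^+ 2 <= a ^+ 2 ->
     (meets_E a b c (sheet1 a b c) /\ ~ meets_E a b c (sheet2 a b c)) \/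
     (~ meets_E a b c (sheet1 a b c) /\ meets_E a b c (sheet2 a b c))) /\
  (2 * c ^+ 2 <= b ^+ 2 ->
     meets_E a b c (sheet1 a b c) /\ meets_E a b c (sheet2 a b c)) /\
  (forall A : R * R * R, onE a b c A -> ~ exceptional a b c A ->
     (~ sheet1 a b c A /\ ~ sheet2 a b c A /\
      ~ inside (sheet1 a b c) A /\ ~ inside (sheet2 a b c) A -> n_eq a b c A 2) /\
     (~ sheet1 a b c A /\ ~ sheet2 a b c A /\
      ((inside (sheet1 a b c) A /\ ~ inside (sheet2 a b c) A) \/
       (~ inside (sheet1 a b c) A /\ inside (sheet2 a b c) A)) -> n_eq a b c A 4) /\
     (~ sheet1 a b c A /\ ~ sheet2 a b c A /\
      inside (sheet1 a b c) A /\ inside (sheet2 a b c) A -> n_eq a b c A 6) /\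
     (sheet1 a b c A \/ sheet2 a b c A -> n_eq a b c A 3 \/ n_eq a b c A 5)).
Proof.
move=> c0 cb ba; split; [|split; [|split]].
- move=> ac; split; first exact: sheet1_misses_E.
  by apply: sheet2_misses_E => //; apply: lt_trans ac; rewrite ltr_pXn2r ?nnegrE ?ltW//;
    [exact: lt_trans cb|exact: lt_trans (lt_trans c0 cb) ba].
(* The sheet that meets the ellipsoid is that of the smaller principal curvature. *)
- by move=> bc ca; left; split; [exact: sheet1_meets_E|exact: sheet2_misses_E].
- move=> cb2; split; last exact: sheet2_meets_E.
  apply: sheet1_meets_E => //; apply: (le_trans cb2).
  by rewrite ler_pXn2r ?nnegrE ?ltW//;
    [exact: lt_trans cb|exact: lt_trans (lt_trans c0 cb) ba].
- by move=> A AE nexc; exact: normal_count.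
Qed.
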